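(* Let $p$ be a prime and let $R\to S$ be a homomorphism of (ordinary, commutative) $F$-finite $\mathbf{F}_p$-algebras. Then it admits a factorization through ordinary commutative rings $$R\to R'\to T\to S$$ where $R'$ is a polynomial ring over $R$ in finitely many variables, the (discrete) relative Frobenius map $F_{T/R'}\colon T\otimes_{R',F}R'\to T$, $t\otimes r\mapsto t^pr$, is an isomorphism, and $T\to S$ is surjective. If $R$ is Noetherian, then $R'\to T$ is relatively perfect; if both $R$ and $S$ are Noetherian, then $T$ is Noetherian as well. (That is, the factorization can be chosen such that these additional properties hold.)
   Context: An $\mathbf{F}_p$-algebra is $F$-finite if its Frobenius endomorphism $F\colon x\mapsto x^p$ is a finite ring map. For a map $A\to B$ of ordinary commutative $\mathbf{F}_p$-algebras, $B\otimes_{A,F}A$ denotes the tensor product of $A\to B$ with $F\colon A\to A$, and $F_*A$ denotes $A$ viewed as an $A$-module via $F$. The map $A\to B$ is relatively perfect if the derived relative Frobenius map $B\otimes^L_{A,F}A\to B$ is an equivalence; equivalently, the discrete relative Frobenius $B\otimes_{A,F}A\to B$, $b\otimes a\mapsto b^pa$, is an isomorphism and $B$ and $F_*A$ are Tor-independent over $A$. *)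

(* Defs.v *)
From HB Require Import structures.
From mathcomp Require Import all_boot all_algebra.
From mathcomp Require Import boolp.

Set Implicit Arguments.
Unset Strict Implicit.
Unset Printing Implicit Defensive.

Import GRing.Theory.
Local Open Scope ring_scope.
Local Open Scope quotient_scope.

(* Rings are [comPzRingType]s, so that the zero ring is allowed.  Since [pchar],
   [pFrobenius_aut], [{poly _}] and [{mpoly _}] are only available for nonzero
   rings, their analogues are defined below. *)

Definition is_Fp_algebra (p : nat) (A : comPzRingType) : bool :=
  prime p && (p%:R == 0 :> A).

Lemma Fp_algebra_rmorph (p : nat) (A B : comPzRingType) (f : {rmorphism A -> B}) :
  is_Fp_algebra p A -> is_Fp_algebra p B.
Proof.
by case/andP=> pp /eqP pA; rewrite /is_Fp_algebra pp -(rmorph_nat f) pA rmorph0 /=.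
Qed.

Definition Frobenius (p : nat) (A : comPzRingType) (chA : is_Fp_algebra p A) :
  A -> A := fun x => x ^+ p.

Section FrobeniusMorphism.
Variables (p : nat) (A : comPzRingType) (chA : is_Fp_algebra p A).

Lemma Frobenius_nmod_morphism : nmod_morphism (Frobenius chA).
Proof.
case/andP: (chA) => pp /eqP pA0; rewrite /Frobenius; split=> [|x y].
  by rewrite expr0n; case: (p) pp.
rewrite -(ltn_predK (prime_gt0 pp)) exprDn.
rewrite big_ord_recr big_ord_recl /= subnn subn0 !expr0 bin0 binn !mulr1n mulr1 mul1r.
rewrite big1 ?addr0 // => i _.
have /dvdnP[q ->] : (p %| 'C(p.-1.+1, bump 0 i))%N.
  rewrite (ltn_predK (prime_gt0 pp)) prime_dvd_bin //= /bump /= add1n.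
  by rewrite -ltn_predRL.
by rewrite -mulr_natl natrM pA0 mulr0 mul0r.
Qed.

Lemma Frobenius_monoid_morphism : monoid_morphism (Frobenius chA).
Proof. by split=> [|x y]; rewrite /Frobenius ?expr1n ?exprMn. Qed.

HB.instance Definition _ :=
  GRing.isNmodMorphism.Build A A (Frobenius chA) Frobenius_nmod_morphism.
HB.instance Definition _ :=
  GRing.isMonoidMorphism.Build A A (Frobenius chA) Frobenius_monoid_morphism.
End FrobeniusMorphism.

Definition finite_rmorphism (A B : comPzRingType) (f : {rmorphism A -> B}) : Prop :=
  exists s : seq B, forall b : B,
    exists c : 'I_(size s) -> A, b = \sum_(i < size s) f (c i) * s`_i.

Definition F_finite (p : nat) (A : comPzRingType) (chA : is_Fp_algebra p A) : Prop :=
  finite_rmorphism (Frobenius chA).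

Definition is_ideal (A : comPzRingType) (I : A -> Prop) : Prop :=
  [/\ I 0, forall x y, I x -> I y -> I (x + y) & forall a x, I x -> I (a * x)].

Definition noetherian (A : comPzRingType) : Prop :=
  forall I : A -> Prop, is_ideal I ->
    exists s : seq A, forall x : A,
      I x <-> exists c : 'I_(size s) -> A, x = \sum_(i < size s) c i * s`_i.

Definition surjective (X Y : Type) (f : X -> Y) : Prop :=
  forall y, exists x, f x = y.

(* [P] is a polynomial ring over [A] in the variables [x]: every element is a
   linear combination of the monomials in the [x j], with unique coefficients.
   Degrees in each variable are bounded by an arbitrary [N] to get finite sums. *)
Definition polynomial_eval (A P : comPzRingType) (i : {rmorphism A -> P})
    (n : nat) (x : 'I_n -> P) (N : nat) (c : {ffun 'I_n -> 'I_N} -> A) : P :=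
  \sum_(m : {ffun 'I_n -> 'I_N}) i (c m) * \prod_(j < n) x j ^+ m j.

Definition is_polynomial_ring_in (A P : comPzRingType) (i : {rmorphism A -> P})
    (n : nat) (x : 'I_n -> P) : Prop :=
  (forall q : P, exists (N : nat) (c : {ffun 'I_n -> 'I_N} -> A),
     q = polynomial_eval i x c) /\
  (forall (N : nat) (c : {ffun 'I_n -> 'I_N} -> A),
     polynomial_eval i x c = 0 -> forall m, c m = 0).

Definition is_polynomial_ring (A P : comPzRingType) (i : {rmorphism A -> P}) : Prop :=
  exists (n : nat) (x : 'I_n -> P), is_polynomial_ring_in i x.

Definition restr (A B : comPzRingType) (f : {rmorphism A -> B}) : Type := B.

Section Restriction.
Variables (A B : comPzRingType) (f : {rmorphism A -> B}).
HB.instance Definition _ := GRing.ComPzRing.on (restr f).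

Definition restr_scale (a : A) (b : restr f) : restr f := f a * (b : B).

Fact restr_scaleA a b v : restr_scale a (restr_scale b v) = restr_scale (a * b) v.
Proof. by rewrite /restr_scale rmorphM mulrA. Qed.
Fact restr_scale1 : left_id 1 restr_scale.
Proof. by move=> v; rewrite /restr_scale rmorph1 mul1r. Qed.
Fact restr_scaleDr : right_distributive restr_scale +%R.
Proof. by move=> a u v; rewrite /restr_scale mulrDr. Qed.
Fact restr_scaleDl v : {morph restr_scale^~ v : a b / a + b}.
Proof. by move=> a b; rewrite /restr_scale rmorphD mulrDl. Qed.

HB.instance Definition _ := GRing.Zmodule_isLmodule.Build A (restr f)
  restr_scaleA restr_scale1 restr_scaleDr restr_scaleDl.
End Restriction.

(* A list [:: (m1, n1); ...; (mk, nk)] stands for the formal sum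
   m1 (x) n1 + ... + mk (x) nk, and [tens_eqv] is the congruence defining the
   tensor product.  The rule [tens_0] gives additive inverses. *)
Inductive tens_eqv (A : comPzRingType) (M N : lmodType A) :
    seq (M * N) -> seq (M * N) -> Prop :=
| tens_refl s : tens_eqv s s
| tens_sym s t : tens_eqv s t -> tens_eqv t s
| tens_trans s t u : tens_eqv s t -> tens_eqv t u -> tens_eqv s u
| tens_cat s s' t t' :
    tens_eqv s s' -> tens_eqv t t' -> tens_eqv (s ++ t) (s' ++ t')
| tens_catC s t : tens_eqv (s ++ t) (t ++ s)
| tens_0 n : tens_eqv [:: (0, n)] [::]
| tens_Dl m m' n : tens_eqv [:: (m + m', n)] [:: (m, n); (m', n)]
| tens_Dr m n n' : tens_eqv [:: (m, n + n')] [:: (m, n); (m, n')]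
| tens_Z a m n : tens_eqv [:: (a *: m, n)] [:: (m, a *: n)].

Section Tensor.
Variables (A : comPzRingType) (M N : lmodType A).
Implicit Types (s t : seq (M * N)).

Definition tens_rel s t : bool := `[< tens_eqv s t >].

Fact tens_rel_equiv : equiv_class_of tens_rel.
Proof.
split=> [s | s t | t s u].
- exact/asboolP/tens_refl.
- by apply/asboolP/asboolP=> /tens_sym.
- by move=> /asboolP st /asboolP tu; apply/asboolP/(tens_trans st tu).
Qed.

Canonical tens_equiv : equiv_rel (seq (M * N)) := EquivRelPack tens_rel_equiv.

Definition tensor : Type := {eq_quot tens_equiv}.
HB.instance Definition _ : Choice tensor := Choice.on tensor.
HB.instance Definition _ : EqQuotient _ tens_equiv tensor := EqQuotient.on tensor.

Definition tens_of s : tensor := \pi_tensor s.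

Lemma tens_ofP s t : reflect (tens_eqv s t) (tens_of s == tens_of t).
Proof. by rewrite /tens_of piE; apply: asboolP. Qed.

Lemma tens_of_eq s t : tens_eqv s t -> tens_of s = tens_of t.
Proof. by move=> st; apply/eqP/tens_ofP. Qed.

Lemma tens_repr s : tens_eqv (repr (tens_of s)) s.
Proof. by apply/tens_ofP; rewrite /tens_of reprK. Qed.

Definition tens_scale_seq (a : A) s := [seq (a *: u.1, u.2) | u <- s].

Definition tens_zero : tensor := tens_of [::].
Definition tens_add (x y : tensor) : tensor := tens_of (repr x ++ repr y).
Definition tens_scale (a : A) (x : tensor) : tensor :=
  tens_of (tens_scale_seq a (repr x)).
Definition tens_opp := tens_scale (-1).

Lemma tens_addE s t : tens_add (tens_of s) (tens_of t) = tens_of (s ++ t).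
Proof. by apply/tens_of_eq/tens_cat; apply: tens_repr. Qed.

Lemma tens_scale_eqv a s t :
  tens_eqv s t -> tens_eqv (tens_scale_seq a s) (tens_scale_seq a t).
Proof.
rewrite /tens_scale_seq; elim=> {s t} [s|s t _|s t u _ + _|s s' t t' _ + _|s t|n|m m' n|m n n'|b m n] /=.
- exact: tens_refl.
- exact: tens_sym.
- exact: tens_trans.
- by rewrite !map_cat; apply: tens_cat.
- by rewrite !map_cat; apply: tens_catC.
- by rewrite scaler0; apply: tens_0.
- by rewrite scalerDr; apply: tens_Dl.
- exact: tens_Dr.
- by rewrite scalerA mulrC -scalerA; apply: tens_Z.
Qed.

Lemma tens_scaleE a s : tens_scale a (tens_of s) = tens_of (tens_scale_seq a s).
Proof. by apply/tens_of_eq/tens_scale_eqv/tens_repr. Qed.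

Lemma tens_elimP (x : tensor) : exists s, x = tens_of s.
Proof. by exists (repr x); rewrite /tens_of reprK. Qed.

Fact tens_addA : associative tens_add.
Proof.
move=> x y z; have [[s ->] [t ->]] := (tens_elimP x, tens_elimP y).
by have [u ->] := tens_elimP z; rewrite !tens_addE catA.
Qed.
Fact tens_addC : commutative tens_add.
Proof.
move=> x y; have [[s ->] [t ->]] := (tens_elimP x, tens_elimP y).
by rewrite !tens_addE; apply/tens_of_eq/tens_catC.
Qed.
Fact tens_add0 : left_id tens_zero tens_add.
Proof. by move=> x; have [s ->] := tens_elimP x; rewrite tens_addE. Qed.

Fact tens_scaleDl x : {morph tens_scale^~ x : a b / a + b >-> tens_add a b}.
Proof.
have [s ->] := tens_elimP x; move=> a b; rewrite !tens_scaleE tens_addE.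
apply: tens_of_eq; elim: s => [|[m n] s IHs] /=; first exact: tens_refl.
rewrite scalerDl.
apply: tens_trans (tens_cat (tens_Dl _ _ _) IHs) _ => /=.
set sa := tens_scale_seq a s; set sb := tens_scale_seq b s.
have bsa := tens_cat (tens_catC [:: (b *: m, n)] sa) (tens_refl sb).
rewrite -!catA in bsa; exact: (tens_cat (tens_refl [:: (a *: m, n)]) bsa).
Qed.

Fact tens_scale0 x : tens_scale 0 x = tens_zero.
Proof.
have [s ->] := tens_elimP x; rewrite tens_scaleE.
apply: tens_of_eq; elim: s => [|[m n] s IHs] /=; first exact: tens_refl.
by rewrite scale0r; apply: (@tens_cat _ _ _ [:: _] [::] _ [::]) IHs; apply: tens_0.
Qed.

Fact tens_scale1 : left_id 1 tens_scale.
Proof.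
move=> x; have [s ->] := tens_elimP x; rewrite tens_scaleE /tens_scale_seq.
by congr tens_of; apply: map_id_in => -[m n] _ /=; rewrite scale1r.
Qed.

Fact tens_addN : left_inverse tens_zero tens_opp tens_add.
Proof.
by move=> x; rewrite -{2}[x]tens_scale1 -tens_scaleDl addNr tens_scale0.
Qed.

HB.instance Definition _ :=
  GRing.isZmodule.Build tensor tens_addA tens_addC tens_add0 tens_addN.

Fact tens_scaleA a b x : tens_scale a (tens_scale b x) = tens_scale (a * b) x.
Proof.
have [s ->] := tens_elimP x; rewrite !tens_scaleE /tens_scale_seq -map_comp.
by congr tens_of; apply: eq_map => u /=; rewrite scalerA.
Qed.
Fact tens_scaleDr : right_distributive tens_scale +%R.
Proof.
move=> a x y; have [[s ->] [t ->]] := (tens_elimP x, tens_elimP y).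
by rewrite -[_ + _]/(tens_add _ _) -[RHS]/(tens_add _ _)
  !(tens_addE, tens_scaleE) /tens_scale_seq map_cat.
Qed.

HB.instance Definition _ := GRing.Zmodule_isLmodule.Build A tensor
  tens_scaleA tens_scale1 tens_scaleDr tens_scaleDl.

Definition pure_tensor (m : M) (n : N) : tensor := tens_of [:: (m, n)].

Lemma tens_of_sum s : tens_of s = \sum_(u <- s) pure_tensor u.1 u.2.
Proof.
elim: s => [|[m n] s IHs]; rewrite ?big_nil // big_cons -IHs.
by rewrite -[RHS]/(tens_add _ _) tens_addE.
Qed.

Lemma tensor_ind (P : tensor -> Prop) :
    P 0 -> (forall x y, P x -> P y -> P (x + y)) ->
    (forall m n, P (pure_tensor m n)) ->
  forall x, P x.
Proof.
move=> P0 PD Pp x; have [s ->] := tens_elimP x.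
by rewrite tens_of_sum; elim/big_ind: _ => // u _; apply: Pp.
Qed.

Lemma pure_tensorDl m m' n :
  pure_tensor (m + m') n = pure_tensor m n + pure_tensor m' n.
Proof. by rewrite -[RHS]/(tens_add _ _) tens_addE; apply/tens_of_eq/tens_Dl. Qed.
Lemma pure_tensorDr m n n' :
  pure_tensor m (n + n') = pure_tensor m n + pure_tensor m n'.
Proof. by rewrite -[RHS]/(tens_add _ _) tens_addE; apply/tens_of_eq/tens_Dr. Qed.
Lemma pure_tensorZl a m n : pure_tensor (a *: m) n = a *: pure_tensor m n.
Proof. by rewrite -[RHS]/(tens_scale _ _) tens_scaleE. Qed.
Lemma pure_tensorZr a m n : pure_tensor m (a *: n) = a *: pure_tensor m n.
Proof. by rewrite -pure_tensorZl; apply/tens_of_eq/tens_sym/tens_Z. Qed.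

Definition balanced (V : zmodType) (b : M -> N -> V) : Prop :=
  [/\ forall m m' n, b (m + m') n = b m n + b m' n,
      forall m n n', b m (n + n') = b m n + b m n' &
      forall a m n, b (a *: m) n = b m (a *: n)].

Definition tens_lift (V : zmodType) (b : M -> N -> V) (x : tensor) : V :=
  \sum_(u <- repr x) b u.1 u.2.

Section Lift.
Variables (V : zmodType) (b : M -> N -> V) (bal : balanced b).

Lemma tens_lift_eqv s t : tens_eqv s t ->
  \sum_(u <- s) b u.1 u.2 = \sum_(u <- t) b u.1 u.2.
Proof.
case: bal => bDl bDr bZ; elim=> {s t} // [s t u _ -> _ -> //|s s' t t' _ + _ +|s t|n|m m' n|m n n'|a m n].
- by rewrite !big_cat /= => -> ->.
- by rewrite !big_cat /= addrC.
- rewrite big_seq1 big_nil /=; apply: (addrI (b 0 n)).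
  by rewrite -bDl !addr0.
- by rewrite !big_cons !big_nil /= bDl !addr0.
- by rewrite !big_cons !big_nil /= bDr !addr0.
- by rewrite !big_seq1 /= bZ.
Qed.

Lemma tens_lift_of s : tens_lift b (tens_of s) = \sum_(u <- s) b u.1 u.2.
Proof. exact/tens_lift_eqv/tens_repr. Qed.

Lemma tens_lift_pure m n : tens_lift b (pure_tensor m n) = b m n.
Proof. by rewrite tens_lift_of big_seq1. Qed.

Lemma tens_liftD : {morph tens_lift b : x y / x + y}.
Proof.
move=> x y; have [[s ->] [t ->]] := (tens_elimP x, tens_elimP y).
by rewrite -[_ + _]/(tens_add _ _) tens_addE !tens_lift_of big_cat.
Qed.

Lemma tens_lift0 : tens_lift b 0 = 0.
Proof. by rewrite -[0]/(tens_of [::]) tens_lift_of big_nil. Qed.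
End Lift.

End Tensor.

Definition tensor_map (A : comPzRingType) (M N N' : lmodType A)
    (d : {linear N -> N'}) : tensor M N -> tensor M N' :=
  tens_lift (fun m n => pure_tensor m (d n)).

Section TensorMap.
Variables (A : comPzRingType) (M N N' : lmodType A) (d : {linear N -> N'}).

Fact tensor_map_balanced : balanced (fun (m : M) n => pure_tensor m (d n)).
Proof.
split=> [m m' n|m n n'|a m n]; first exact: pure_tensorDl.
  by rewrite linearD pure_tensorDr.
by rewrite linearZ /= pure_tensorZr pure_tensorZl.
Qed.

Lemma tensor_map_pure m n :
  tensor_map d (pure_tensor m n) = pure_tensor m (d n) :> tensor M N'.
Proof. exact/tens_lift_pure/tensor_map_balanced. Qed.

Fact tensor_map_linear : linear (@tensor_map A M N N' d).
Proof.
have D := tens_liftD tensor_map_balanced; move=> a x y.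
rewrite /tensor_map D -/(tensor_map d _) -/(tensor_map d _); congr (_ + _).
elim/tensor_ind: x => [|u v IHu IHv|m n].
- by rewrite /tensor_map !(scaler0, tens_lift0 tensor_map_balanced).
- by rewrite scalerDr /tensor_map !D -!/(tensor_map d _) IHu IHv -scalerDr.
- by rewrite -pure_tensorZl -/(tensor_map d _) !tensor_map_pure pure_tensorZl.
Qed.
HB.instance Definition _ := GRing.isLinear.Build A (tensor M N) (tensor M N')
  *:%R (@tensor_map A M N N' d) tensor_map_linear.
End TensorMap.

Definition algtensor (A B C : comPzRingType)
    (f : {rmorphism A -> B}) (g : {rmorphism A -> C}) : Type :=
  tensor (restr f) (restr g).

Section AlgTensor.
Variables (A B C : comPzRingType).
Variables (f : {rmorphism A -> B}) (g : {rmorphism A -> C}).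
Local Notation BC := (algtensor f g).
HB.instance Definition _ := GRing.Lmodule.on BC.

Definition alg_pure (b : B) (c : C) : BC :=
  @pure_tensor A (restr f) (restr g) b c.

(* (b (x) c) * (b' (x) c') = (b * b') (x) (c * c') *)
Definition algtensor_mul (x y : BC) : BC :=
  tens_lift (fun (b : restr f) (c : restr g) =>
    tens_lift (fun (b' : restr f) (c' : restr g) =>
      alg_pure (b * b') (c * c')) y) x.

Fact algtensor_mul_bal2 (b : restr f) (c : restr g) :
  balanced (fun (b' : restr f) (c' : restr g) => alg_pure (b * b') (c * c')).
Proof.
rewrite /alg_pure; split=> [m m' n|m n n'|a m n].
- by rewrite mulrDr pure_tensorDl.
- by rewrite mulrDr pure_tensorDr.
- have -> : b * (a *: m) = a *: (b * m) by apply: mulrCA.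
  have -> : c * (a *: n) = a *: (c * n) by apply: mulrCA.
  by rewrite pure_tensorZl pure_tensorZr.
Qed.

Fact algtensor_mul_bal1 (y : BC) :
  balanced (fun (b : restr f) (c : restr g) =>
    tens_lift (fun (b' : restr f) (c' : restr g) => alg_pure (b * b') (c * c')) y).
Proof.
pose L b c := tens_liftD (algtensor_mul_bal2 b c).
pose L0 b c := tens_lift0 (algtensor_mul_bal2 b c).
pose Lp b c := tens_lift_pure (algtensor_mul_bal2 b c).
split=> [m m' n|m n n'|a m n]; elim/tensor_ind: y => [|u v IHu IHv|b c].
- by rewrite !L0 addr0.
- by rewrite !L IHu IHv addrACA.
- by rewrite !Lp mulrDl /alg_pure pure_tensorDl.
- by rewrite !L0 addr0.
- by rewrite !L IHu IHv addrACA.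
- by rewrite !Lp mulrDl /alg_pure pure_tensorDr.
- by rewrite !L0.
- by rewrite !L IHu IHv.
- rewrite !Lp /alg_pure.
  have -> : a *: m * b = a *: (m * b) by exact: esym (mulrA (f a : B) m b).
  have -> : a *: n * c = a *: (n * c) by exact: esym (mulrA (g a : C) n c).
  by rewrite pure_tensorZl pure_tensorZr.
Qed.

Lemma algtensor_mul_pure b c b' c' :
  algtensor_mul (alg_pure b c) (alg_pure b' c') = alg_pure (b * b') (c * c').
Proof.
rewrite /algtensor_mul (tens_lift_pure (algtensor_mul_bal1 _)).
exact: (tens_lift_pure (algtensor_mul_bal2 _ _)).
Qed.

Fact algtensor_mulDl : left_distributive algtensor_mul +%R.
Proof. by move=> x y z; apply: (tens_liftD (algtensor_mul_bal1 _)). Qed.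

Fact algtensor_mul0l x : algtensor_mul 0 x = 0.
Proof. exact: (tens_lift0 (algtensor_mul_bal1 _)). Qed.

Fact algtensor_mulC : commutative algtensor_mul.
Proof.
have mul0 x : algtensor_mul x 0 = 0.
  elim/tensor_ind: x => [|u v IHu IHv|b c]; first exact: algtensor_mul0l.
    by rewrite algtensor_mulDl IHu IHv addr0.
  rewrite /algtensor_mul (tens_lift_pure (algtensor_mul_bal1 _)).
  exact: (tens_lift0 (algtensor_mul_bal2 _ _)).
have mulD x y z : algtensor_mul x (y + z) = algtensor_mul x y + algtensor_mul x z.
  elim/tensor_ind: x => [|u v IHu IHv|b c]; first by rewrite !algtensor_mul0l addr0.
    by rewrite !algtensor_mulDl IHu IHv addrACA.
  rewrite /algtensor_mul !(tens_lift_pure (algtensor_mul_bal1 _)).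
  exact: (tens_liftD (algtensor_mul_bal2 _ _)).
move=> x y; elim/tensor_ind: x => [|u v IHu IHv|b c].
- by rewrite algtensor_mul0l mul0.
- by rewrite algtensor_mulDl mulD IHu IHv.
elim/tensor_ind: y => [|u v IHu IHv|b' c'].
- by rewrite algtensor_mul0l mul0.
- by rewrite algtensor_mulDl mulD IHu IHv.
- by rewrite !algtensor_mul_pure mulrC [c * _]mulrC.
Qed.

Fact algtensor_mulA : associative algtensor_mul.
Proof.
have mulDr := algtensor_mulDl; have mul0r := algtensor_mul0l.
have mulD x y z : algtensor_mul x (y + z) = algtensor_mul x y + algtensor_mul x z.
  by rewrite !(algtensor_mulC x) mulDr.
have mul0 x : algtensor_mul x 0 = 0 by rewrite algtensor_mulC mul0r.
move=> x y z; elim/tensor_ind: x => [|u v IHu IHv|b c]; rewrite ?mul0r //.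
  by rewrite !mulDr IHu IHv.
elim/tensor_ind: y => [|u v IHu IHv|b' c']; rewrite ?(mul0r, mul0) //.
  by rewrite !(mulDr, mulD) IHu IHv.
elim/tensor_ind: z => [|u v IHu IHv|b'' c'']; rewrite ?mul0 //.
  by rewrite !mulD IHu IHv.
by rewrite !algtensor_mul_pure !mulrA.
Qed.

Fact algtensor_mul1 : left_id (alg_pure 1 1) algtensor_mul.
Proof.
move=> x; elim/tensor_ind: x => [|u v IHu IHv|b c].
- by rewrite algtensor_mulC algtensor_mul0l.
- by rewrite algtensor_mulC algtensor_mulDl -!(algtensor_mulC (alg_pure 1 1)) IHu IHv.
- by rewrite algtensor_mul_pure !mul1r.
Qed.

HB.instance Definition _ := GRing.Zmodule_isComPzRing.Build BC
  algtensor_mulA algtensor_mulC algtensor_mul1 algtensor_mulDl.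
End AlgTensor.

(* B (x)_{A,F} A -> B, b (x) a |-> b^p a *)
Definition rel_Frobenius (p : nat) (A B : comPzRingType) (f : {rmorphism A -> B})
    (chA : is_Fp_algebra p A) : algtensor f (Frobenius chA) -> B :=
  tens_lift (fun (b : restr f) (a : restr (Frobenius chA)) =>
    Frobenius (Fp_algebra_rmorph f chA) b * f a).

Section RelFrobenius.
Variables (p : nat) (A B : comPzRingType) (f : {rmorphism A -> B}).
Variable (chA : is_Fp_algebra p A).
Let chB := Fp_algebra_rmorph f chA.

Fact rel_Frobenius_balanced :
  balanced (fun (b : restr f) (a : restr (Frobenius chA)) => Frobenius chB b * f a).
Proof.
split=> [m m' n|m n n'|a m n].
- by rewrite rmorphD mulrDl.
- by rewrite -mulrDr -rmorphD.
- rewrite -[a *: m]/(f a * m : B) -[a *: n]/(Frobenius chA a * n : A) !rmorphM.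
  by rewrite /Frobenius rmorphXn /= -mulrA mulrCA.
Qed.

Lemma rel_Frobenius_pure (b : B) (a : A) :
  rel_Frobenius (alg_pure f (Frobenius chA) b a) = b ^+ p * f a.
Proof. exact: (tens_lift_pure rel_Frobenius_balanced). Qed.

Fact rel_Frobenius_nmod_morphism : nmod_morphism (rel_Frobenius (f := f) (chA := chA)).
Proof.
split; first exact: tens_lift0 rel_Frobenius_balanced.
exact: tens_liftD rel_Frobenius_balanced.
Qed.
HB.instance Definition _ := GRing.isNmodMorphism.Build
  (algtensor f (Frobenius chA)) B (@rel_Frobenius p A B f chA)
  rel_Frobenius_nmod_morphism.

Fact rel_Frobenius_monoid_morphism :
  monoid_morphism (rel_Frobenius (f := f) (chA := chA)).
Proof.
split; first by rewrite rel_Frobenius_pure rmorph1 expr1n mulr1.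
move=> x y; elim/tensor_ind: x => [|u v IHu IHv|b c].
- by rewrite mul0r !raddf0 mul0r.
- by rewrite mulrDl !raddfD /= IHu IHv mulrDl.
elim/tensor_ind: y => [|u v IHu IHv|b' c'].
- by rewrite mulr0 !raddf0 mulr0.
- by rewrite mulrDr !raddfD /= IHu IHv mulrDr.
rewrite -!/(alg_pure _ _ _ _) -[X in rel_Frobenius X]/(algtensor_mul _ _).
by rewrite algtensor_mul_pure !rel_Frobenius_pure exprMn rmorphM mulrACA.
Qed.
HB.instance Definition _ := GRing.isMonoidMorphism.Build
  (algtensor f (Frobenius chA)) B (@rel_Frobenius p A B f chA)
  rel_Frobenius_monoid_morphism.
End RelFrobenius.

Definition projective (A : comPzRingType) (P : lmodType A) : Prop :=
  forall (X Y : lmodType A) (q : {linear X -> Y}) (u : {linear P -> Y}),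
    surjective q -> exists v : {linear P -> X}, forall z, q (v z) = u z.

(* The augmentation [e], seen as a morphism of complexes from
   ... -> C 2 -> C 1 -> C 0 to V placed in degree 0, is a quasi-isomorphism:
   H_0 is mapped isomorphically onto V and H_n vanishes for n > 0. *)
Definition augmentation_quasi_iso (C : nat -> zmodType)
    (d : forall n, C n.+1 -> C n) (V : zmodType) (e : C 0%N -> V) : Prop :=
  [/\ surjective e,
      forall x, e x = 0 <-> exists y, d 0%N y = x &
      forall n x, d n x = 0 <-> exists y, d n.+1 y = x].

Definition projective_resolution (A : comPzRingType) (N : lmodType A)
    (Q : nat -> lmodType A) (d : forall n, {linear Q n.+1 -> Q n})
    (e : {linear Q 0%N -> N}) : Prop :=
  (forall n, projective (Q n)) /\
  augmentation_quasi_iso (C := Q) (fun n => d n) e.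

(* B (x)^L_{A,F} A is computed by B (x)_A Q for a projective resolution Q of F_*A;
   the derived relative Frobenius is then the composite
   B (x)_A Q -> B (x)_{A,F} A -> B.  Being an equivalence is a condition on the
   underlying complexes and does not depend on the choice of Q. *)
Definition relatively_perfect (p : nat) (A B : comPzRingType)
    (f : {rmorphism A -> B}) (chA : is_Fp_algebra p A) : Prop :=
  forall (Q : nat -> lmodType A) (d : forall n, {linear Q n.+1 -> Q n})
      (e : {linear Q 0%N -> restr (Frobenius chA)}),
    projective_resolution d e ->
    augmentation_quasi_iso (C := fun n => tensor (restr f) (Q n))
      (fun n => tensor_map (d n))
      (fun x => rel_Frobenius (f := f) (chA := chA) (tensor_map e x)).

(* Main.v *)
(** Choose p-generators x of R, let R' = R[y] with one variable y_j for each
    p-generator of S, and let z = (x, y).  For a ring B that is spanned over B^p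
    by the monomials in z, the rings B[X] / (X^(p^e) - z) form a tower of
    surjections, with transition maps b |-> b^p, X |-> X, whose limit B^ has z
    as a p-basis and surjects onto B.  This is functorial, and we take
    T = S^ / I S^, where I is the kernel of R'^ -> R'.  Since R'^ and S^ have the
    same p-basis, the relative Frobenius of S^ over R'^ is bijective, hence so is
    that of its base change T over R'.

    If B is noetherian, so is B^: the kernel of B^ -> B is finitely generated by
    completeness, and a maximal non finitely generated ideal is excluded by
    Cohen's argument.  If R' is noetherian, then S^ is flat over R'^, hence T is
    flat over R' and R' -> T is relatively perfect.  The flatness is proved by
    noetherian induction on J for Tor_1(R'^ / J, S^); when J is prime,
    F_*(R'^ / J) is free over R'^ / J up to modules with smaller support, so that
    Tor_1(R'^ / J, S^) is spanned by the image of its Frobenius, which is 0. *)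

Require Import Defs.
From HB Require Import structures.
From mathcomp Require Import all_boot all_algebra.
From mathcomp Require Import boolp classical_sets.

Set Implicit Arguments.
Unset Strict Implicit.
Unset Printing Implicit Defensive.

Import GRing.Theory.
Local Open Scope ring_scope.

(** * Ideals, submodules and syzygies *)

(** The monomials in [z] span [R'] and [S] over their [p]-th powers, but there may be relations
    between them, so neither ring need have [z] as a [p]-basis; adjoining roots infinitely often
    removes the relations. Write [C] and [D] for the two limits. Since both have the same [p]-basis,
    [F_*C] is free over [C] and [D (x)_C F_*C = F_*D], whence [Tor_1(F_*M, D) = F_* Tor_1(M, D)] for
    a [C]-module [M]. This is how a statement on [F_*(C/P)] says something about [C/P].

    Tor never appears as an object. Its vanishing for a cokernel means that relations over [D] are
    combinations of relations over [C], and every exact sequence used becomes an identity between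
    block matrices. Resolutions and tensor products enter only at the end, through the equational
    criterion for flatness. *)

Definition is_submodule (A : comPzRingType) (s : nat) (L : 'cV[A]_s -> Prop) : Prop :=
  [/\ L 0, forall v w, L v -> L w -> L (v + w) & forall a v, L v -> L (a *: v)].

Definition generates (A : comPzRingType) (s r : nat) (l : 'M[A]_(s, r))
    (L : 'cV[A]_s -> Prop) : Prop :=
  forall v, L v <-> exists u : 'cV_r, v = l *m u.

Definition fg_ideal (A : comPzRingType) (J : A -> Prop) : Prop :=
  exists r (l : 'rV[A]_r), forall x, J x <-> exists u : 'cV_r, x = (l *m u) 0 0.

Section Submodules.
Variable A : comPzRingType.
Implicit Type s r : nat.

Lemma is_submodule_mulmx s r (L : 'cV[A]_s -> Prop) (M : 'M_(s, r)) (u : 'cV_r) :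
  is_submodule L -> (forall j, L (col j M)) -> L (M *m u).
Proof.
move=> [L0 LD LZ] LM.
have -> : M *m u = \sum_j u j 0 *: col j M.
  apply/matrixP=> i k; rewrite ord1 !mxE summxE; apply: eq_bigr => j _.
  by rewrite !mxE mulrC.
by elim/big_ind: _ => // j _; apply: LZ.
Qed.

Lemma generates_factor s r t (l : 'M[A]_(s, r)) L (M : 'M_(s, t)) :
  generates l L -> (forall j, L (col j M)) -> exists B, M = l *m B.
Proof.
move=> gl LM; have /choice[u Hu] : forall j, exists u, col j M = l *m u.
  by move=> j; apply/gl.
exists (\matrix_(i, j) u j i 0); apply/matrixP=> i j.
have /matrixP/(_ i 0) := Hu j; rewrite !mxE => ->.
by apply: eq_bigr => k _; rewrite mxE.
Qed.

Lemma generates_col s r (l : 'M[A]_(s, r)) L j : generates l L -> L (col j l).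
Proof. by move=> gl; apply/gl; exists (delta_mx j 0); rewrite colE. Qed.

End Submodules.

Section Syzygies.
Variables (C D : comPzRingType) (iota : {rmorphism C -> D}).
Local Notation "M ^i" := (map_mx iota M) (at level 2, format "M ^i").

Definition syz_span s r (l : 'M[C]_(s, r)) (d : 'cV[D]_r) : Prop :=
  exists q (E : 'M[C]_(r, q)) (y : 'cV[D]_q), d = E^i *m y /\ l *m E = 0.

(** For [L] the column module of [l], the kernel of [D^r -> L (x) D] is [syz_span l]. The condition
    thus says that [Tor_1(C^s / L, D)] vanishes. *)
Definition syz_generated s r (l : 'M[C]_(s, r)) : Prop :=
  forall d : 'cV[D]_r, l^i *m d = 0 -> syz_span l d.

(** The condition depends only on the column module: [d = B' (B d) + (1 - B' B) d], where [B d] is a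
    relation for [l] and the columns of [1 - B' B] are syzygies of [m]. *)
Lemma syz_generated_factor s r t (l : 'M[C]_(s, r)) (m : 'M_(s, t)) B B' :
  m = l *m B -> l = m *m B' -> syz_generated l -> syz_generated m.
Proof.
move=> mE lE Vl d; rewrite {1}mE map_mxM -mulmxA => /Vl[q [E [y [dE lE0]]]].
exists (q + t)%N, (row_mx (B' *m E) (1%:M - B' *m B)), (col_mx y d).
rewrite map_row_mx mul_row_col map_mxM -mulmxA -dE map_mxB map_mxM map_mx1.
rewrite mulmxBl mul1mx mulmxA subrKC; split=> //.
rewrite mul_mx_row mulmxA -lE lE0 mulmxBr mulmx1 mulmxA -lE -mE subrr.
by rewrite row_mx0.
Qed.

Lemma syz_generated_eq s r t (l : 'M[C]_(s, r)) (m : 'M_(s, t)) L :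
  generates l L -> generates m L -> syz_generated l -> syz_generated m.
Proof.
move=> gl gm.
have [B mE] := generates_factor gl (fun j => generates_col j gm).
have [B' lE] := generates_factor gm (fun j => generates_col j gl).
exact: syz_generated_factor mE lE.
Qed.

Definition syz_good s (L : 'cV[C]_s -> Prop) : Prop :=
  exists r (l : 'M_(s, r)), generates l L /\ syz_generated l.

(** Induction on [s]: [L] is an extension of the ideal of its first coordinates by its intersection
    with [0 x C^s]. The bound [J0] matters later, when only the ideals strictly above a given prime
    are known to be good. *)
Lemma syz_good_filtration (J0 : C -> Prop) :
    (forall J, is_ideal J -> (forall x, J0 x -> J x) ->
       @syz_good 1 (fun v => J (v 0 0))) ->
  forall s (L : 'cV[C]_s -> Prop), is_submodule L ->
    (forall x v, J0 x -> L (x *: v)) -> syz_good L.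
Proof.
move=> good; elim=> [|s IHs] L subL J0L.
  exists 0%N, 0; split=> [v|d _].
    split=> [_|_]; first by exists 0; rewrite mul0mx; apply: flatmx0.
    by rewrite [v]flatmx0; case: subL.
  by exists 0%N, 0, 0; rewrite mul0mx mulmx0; split=> //; apply: flatmx0.
rewrite -[s.+1]/(1 + s)%N in L subL J0L *.
case: (subL) => L0 LD LZ.
have idJ : is_ideal (fun x => exists w : 'cV_s, L (col_mx x%:M w)).
  split=> [|x y [v Lv] [w Lw]|a x [v Lv]].
  - by exists 0; rewrite raddf0 col_mx0.
  - by exists (v + w); rewrite raddfD /= -add_col_mx; apply: LD.
  - by exists (a *: v); rewrite -scale_scalar_mx -scale_col_mx; apply: LZ.
have [|r [c [gc Vc]]] := good _ idJ.
  move=> x J0x; exists 0; suff -> : col_mx x%:M 0 = x *: col_mx 1 (0 : 'cV_s).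
    exact: J0L.
  by rewrite scale_col_mx scaler0 scale_scalar_mx mulr1.
have [| |r' [l' [gl' Vl']]] := IHs (fun w => L (col_mx 0 w)).
- split=> [|v w Lv Lw|a v Lv]; first by rewrite col_mx0.
    by rewrite -[0]addr0 -add_col_mx; apply: LD.
  by rewrite -(scaler0 _ a) -scale_col_mx; apply: LZ.
- by move=> x v J0x; rewrite -(scaler0 _ x) -scale_col_mx; apply: J0L.
have /choice[w Lw] : forall j, exists w : 'cV_s, L (col_mx (c 0 j)%:M w).
  move=> j; have := generates_col j gc; rewrite mxE; apply.
pose W := \matrix_(i, j) w j i 0.
have LcW (u : 'cV_r) : L (col_mx (c *m u) (W *m u)).
  rewrite -mul_col_mx; apply: is_submodule_mulmx => // j.
  suff -> : col j (col_mx c W) = col_mx (c 0 j)%:M (w j) by apply: Lw.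
  rewrite col_col_mx; congr col_mx; apply/matrixP=> i k; rewrite !mxE ?ord1 //.
exists (r + r')%N, (block_mx c 0 W l'); split=> [v|d].
  split=> [Lv|[u ->]]; last first.
    rewrite -[u]vsubmxK mul_block_col mul0mx addr0.
    rewrite -[X in col_mx X _]addr0 -add_col_mx; apply: LD => //.
    by apply/gl'; exists (dsubmx u).
  have [|u uE] := (gc (usubmx v)).1.
    by exists (dsubmx v); rewrite -mx11_scalar vsubmxK.
  have [|u' u'E] := (gl' (dsubmx v - W *m u)).1.
    have := LD _ _ Lv (LZ (-1) _ (LcW u)).
    rewrite -{1}[v]vsubmxK scale_col_mx add_col_mx !scaleN1r -uE subrr; apply.
  exists (col_mx u u'); rewrite mul_block_col mul0mx addr0 -uE -u'E subrKC.
  by rewrite vsubmxK.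
rewrite -[d]vsubmxK map_block_mx raddf0 mul_block_col mul0mx addr0.
rewrite -col_mx0 => /eq_col_mx[/Vc[q [E [y [dE cE]]]] Wd].
(* As [c *m E = 0], the columns of [W *m E] lie in the submodule generated by [l']; the block [- B]
   below compensates for them. *)
have [|B WE] := generates_factor (M := W *m E) gl'.
  move=> j; have := LcW (col j E).
  by rewrite !colE !mulmxA cE mul0mx.
have [|q' [E' [y' [dE' lE']]]] := Vl' (B^i *m y + dsubmx d).
  by rewrite mulmxDr mulmxA -map_mxM -WE map_mxM -mulmxA -dE.
exists (q + q')%N, (block_mx E 0 (- B) E'), (col_mx y y'); split.
  rewrite map_block_mx raddf0 mul_block_col mul0mx addr0 -dE -dE' map_mxN.
  by rewrite mulNmx addKr.
rewrite mulmx_block cE !mul0mx !mulmx0 !addr0 WE mulmxN subrr lE'.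
by rewrite !add0r block_mx0.
Qed.

End Syzygies.

(** * Finitely generated ideals and noetherian induction *)

Section Noetherian.
Variable A : comPzRingType.

Lemma noetherianP : noetherian A <-> forall J : A -> Prop, is_ideal J -> fg_ideal J.
Proof.
split=> noethA J idJ.
  have [s sJ] := noethA J idJ; exists (size s), (\row_i s`_i) => x.
  split=> [/sJ[c ->]|[u ->]].
    exists (\col_i c i); rewrite mxE; apply: eq_bigr => i _.
    by rewrite !mxE mulrC.
  apply/sJ; exists (fun i => u i 0); rewrite mxE; apply: eq_bigr => i _.
  by rewrite !mxE mulrC.
have [r [l lJ]] := noethA J idJ; exists [seq l 0 j | j <- enum 'I_r] => x.
have size_l : size [seq l 0 j | j <- enum 'I_r] = r by rewrite size_map size_enum_ord.
have nth_l (i : 'I_r) : [seq l 0 j | j <- enum 'I_r]`_i = l 0 i.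
  by rewrite (nth_map i) ?size_enum_ord ?nth_ord_enum.
rewrite lJ; split=> [[u ->]|[c ->]].
  exists (fun i => u (cast_ord size_l i) 0); rewrite mxE.
  rewrite (reindex _ (onW_bij _ (Bijective (cast_ordK size_l) (cast_ordKV size_l)))) /=; apply: eq_bigr => i _.
  by rewrite mulrC -nth_l.
exists (\col_i c (cast_ord (esym size_l) i)); rewrite mxE.
rewrite (reindex _ (onW_bij _ (Bijective (cast_ordKV size_l) (cast_ordK size_l)))) /=.
by apply: eq_bigr => i _; rewrite mxE mulrC nth_l.
Qed.

Lemma ideal_mulmx r (J : A -> Prop) (l : 'rV_r) (u : 'cV_r) :
  is_ideal J -> (forall j, J (l 0 j)) -> J ((l *m u) 0 0).
Proof.
move=> [J0 JD JM] Jl; rewrite mxE; elim/big_ind: _ => // j _.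
by rewrite mulrC; apply: JM.
Qed.

Lemma fg_ideal_gen r (l : 'rV[A]_r) (J : A -> Prop) j :
  (forall x, J x <-> exists u : 'cV_r, x = (l *m u) 0 0) -> J (l 0 j).
Proof. by move=> gl; apply/gl; exists (delta_mx j 0); rewrite -colE mxE. Qed.

Lemma generates_ideal r (l : 'rV[A]_r) (J : A -> Prop) :
  (forall x, J x <-> exists u : 'cV_r, x = (l *m u) 0 0) <->
  generates l (fun v : 'cV_1 => J (v 0 0)).
Proof.
split=> gl => [v|x].
  rewrite gl; split=> -[u uE]; exists u; last by rewrite -uE.
  by rewrite [LHS]mx11_scalar uE -mx11_scalar.
have := gl x%:M; rewrite mxE eqxx mulr1n => ->.
split=> -[u uE]; exists u; first by rewrite -uE mxE eqxx mulr1n.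
by rewrite uE -mx11_scalar.
Qed.

Lemma fg_idealP (J : A -> Prop) : is_ideal J ->
  fg_ideal J <-> exists r (l : 'rV_r), (forall j, J (l 0 j)) /\
                 forall x, J x -> exists u : 'cV_r, x = (l *m u) 0 0.
Proof.
move=> idJ; split=> [[r [l gl]]|[r [l [Jl gl]]]]; exists r, l.
  by split=> [j|x /gl//]; apply: fg_ideal_gen gl.
by move=> x; split=> [/gl//|[u ->]]; apply: ideal_mulmx.
Qed.

(** When [iota] is the identity, every relation is itself a syzygy, so being good amounts to finite
    generation. *)
Lemma noetherian_submodule s (L : 'cV[A]_s -> Prop) :
  noetherian A -> is_submodule L -> exists r (l : 'M_(s, r)), generates l L.
Proof.
move=> /noetherianP noethA subL.
have [| |r [l [gl _]]] := @syz_good_filtration _ _ (idfun : {rmorphism A -> A})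
    (fun x => x = 0) _ s L subL; last by exists r, l.
- move=> J idJ _; have [r [l gl]] := noethA J idJ.
  exists r, l; split; first by apply/(generates_ideal l J).
  move=> d; rewrite map_mx_id // => ld0; exists 1%N, d, (1%:M : 'M_1); split=> //.
  by rewrite mulmx1 map_mx_id.
- by move=> _ v ->; rewrite scale0r; case: subL.
Qed.

(* Zorn's lemma gives a maximal counterexample, since the union of a chain of
   counterexamples would otherwise be finitely generated, hence in the chain. *)
Lemma ideal_ind (G : (A -> Prop) -> Prop) :
    (forall J, is_ideal J -> G J -> fg_ideal J) ->
    (forall J, is_ideal J ->
       (forall J', is_ideal J' -> (forall x, J x -> J' x) ->
          (exists x, J' x /\ ~ J x) -> G J') ->
       G J) ->
  forall J, is_ideal J -> G J.
Proof.
move=> G_fg IH J0 idJ0; apply: contrapT => nGJ0.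
pose T := {J : A -> Prop | is_ideal J /\ ~ G J}.
pose R (s t : T) := `[< forall x, sval s x -> sval t x >].
have Rsub (s t : T) : R s t -> forall x, sval s x -> sval t x by move/asboolP.
have [|r s t rs st|s t st ts|chain tot|[J [idJ nGJ]] Jmax] := @Zorn T R.
- by move=> s; apply/asboolP.
- by apply/asboolP=> x /(Rsub _ _ rs)/(Rsub _ _ st).
- case: s t st ts => [Js s] [Jt t] /(Rsub _ _)/= st /(Rsub _ _)/= ts.
  have E : Js = Jt by apply/funext => x; apply/propext; split=> [/st|/ts].
  by move: s t {st ts}; rewrite E => s t; congr exist; apply: Prop_irrelevance.
- have [[J1 chJ1]|noch] := pselect (exists J1, chain J1); last first.
    exists (exist _ J0 (conj idJ0 nGJ0)) => s chs.
    by case: noch; exists s.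
  pose U x := exists2 s, chain s & sval s x.
  have idU : is_ideal U.
    split=> [|x y [s chs sx] [t cht ty]|a x [s chs sx]].
    - by exists J1 => //; case: (svalP J1) => -[].
    - have [st|ts] := tot s t chs cht.
        exists t => //; case: (svalP t) => -[_ tD _] _.
        by apply: tD => //; apply: Rsub st _ _.
      exists s => //; case: (svalP s) => -[_ sD _] _.
      by apply: sD => //; apply: Rsub ts _ _.
    - by exists s => //; case: (svalP s) => -[_ _ sM] _; apply: sM.
  have [GU|nGU] := pselect (G U); last first.
    exists (exist _ U (conj idU nGU)) => s chs.
    by apply/asboolP=> x sx; exists s.
  have [r [l gl]] := G_fg _ idU GU.
  have [s chs sl] : exists2 s, chain s & forall j, sval s (l 0 j).
    have Ul j : U (l 0 j) by apply: fg_ideal_gen gl.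
    suff /(_ (enum 'I_r))[s chs sl] : forall e : seq 'I_r,
        exists2 s, chain s & forall j, j \in e -> sval s (l 0 j).
      by exists s => // j; apply: sl; rewrite mem_enum.
    elim=> [|j e [s chs sl]]; first by exists J1.
    have [t cht tj] := Ul j; have [st|ts] := tot s t chs cht.
      exists t => // k; rewrite inE => /predU1P[->//|ke].
      exact: Rsub st _ (sl _ ke).
    exists s => // k; rewrite inE => /predU1P[->|ke]; last exact: sl.
    exact: Rsub ts _ tj.
  case: (svalP s) => ids; case.
  suff -> : sval s = U by [].
  apply: funext => x; apply: propext; split=> [sx|/gl[u ->]]; first by exists s.
  exact: ideal_mulmx.
- apply: (nGJ); apply: IH => // J' idJ' JJ' [x [J'x nJx]]; apply: contrapT => nGJ'.
  have := Jmax (exist _ J' (conj idJ' nGJ')) (asboolT JJ').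
  by move=> [/(congr1 (fun K => K x)) /= E]; apply: nJx; rewrite -E.
Qed.

End Noetherian.

(** * Adjoining p-th roots *)

Section Exponents.
Variables (p : nat) (pp : prime p) (I : finType).
Implicit Types (a b : {ffun I -> nat}) (k : {ffun I -> 'I_p}).

Definition expo_val k : {ffun I -> nat} := [ffun i => k i : nat].
Definition expo_mod a : {ffun I -> 'I_p} :=
  [ffun i => Ordinal (ltn_pmod (a i) (prime_gt0 pp))].
Definition expo_div a : {ffun I -> nat} := [ffun i => (a i %/ p)%N].
Definition expo_add a b : {ffun I -> nat} := [ffun i => (a i + b i)%N].
Definition expo_mul a : {ffun I -> nat} := [ffun i => (p * a i)%N].
Definition expo0 : {ffun I -> nat} := [ffun=> 0%N].

Lemma expo_modK k : expo_mod (expo_val k) = k.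
Proof. by apply/ffunP=> i; rewrite !ffunE; apply: val_inj; rewrite /= modn_small. Qed.

Lemma expo_div_val k : expo_div (expo_val k) = expo0.
Proof. by apply/ffunP=> i; rewrite !ffunE divn_small. Qed.

Lemma expo_divmod a : expo_add (expo_mul (expo_div a)) (expo_val (expo_mod a)) = a.
Proof. by apply/ffunP=> i; rewrite !ffunE /= mulnC -divn_eq. Qed.

Lemma expo_addC : commutative expo_add.
Proof. by move=> a b; apply/ffunP=> i; rewrite !ffunE addnC. Qed.
Lemma expo_addA : associative expo_add.
Proof. by move=> a b c; apply/ffunP=> i; rewrite !ffunE addnA. Qed.
Lemma expo_add0 : left_id expo0 expo_add.
Proof. by move=> a; apply/ffunP=> i; rewrite !ffunE. Qed.

Lemma expo_mod_addmul a b : expo_mod (expo_add a (expo_mul b)) = expo_mod a.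
Proof.
by apply/ffunP=> i; rewrite !ffunE; apply: val_inj; rewrite /= addnC mulnC modnMDl.
Qed.

Lemma expo_div_addmul a b :
  expo_div (expo_add a (expo_mul b)) = expo_add (expo_div a) b.
Proof.
by apply/ffunP=> i; rewrite !ffunE mulnC addnC divnMDl ?prime_gt0 // addnC.
Qed.

End Exponents.

(* An F_p-algebra with a family of elements z_i, encoded by a |-> z^a. *)
Record pring (p : nat) (I : finType) := PRing {
  pr_car :> comPzRingType;
  pr_char : is_Fp_algebra p pr_car;
  mon : {ffun I -> nat} -> pr_car;
  mon0 : mon (expo0 I) = 1;
  monD : forall a b, mon (expo_add a b) = mon a * mon b }.

Section Ext.
Variables (p : nat) (pp : prime p) (I : finType).
Implicit Types (B : pring p I).
Local Notation K := {ffun I -> 'I_p}.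
Local Notation N := {ffun I -> nat}.

Lemma mon_exp B (a : N) n : mon B [ffun i => (n * a i)%N] = mon B a ^+ n.
Proof.
elim: n => [|n IHn].
  by rewrite expr0 -(mon0 B); congr mon; apply/ffunP=> i; rewrite !ffunE.
rewrite exprS -IHn -monD; congr mon; apply/ffunP=> i.
by rewrite !ffunE mulSn.
Qed.

(* B[X] / (X_i^p - z_i), on the basis of the monomials X^k with k_i < p. *)
Definition ext (pp : prime p) B : Type := {ffun K -> B}.
HB.instance Definition _ (B : pring p I) := GRing.Zmodule.on (ext pp B).

Section ExtRing.
Variable B : pring p I.
Local Notation E := (ext pp B).
Implicit Types (a b : N) (x y : B) (u v w : E).

(** The element [x X^a] for an arbitrary exponent [a], reduced by [X_i^p = z_i]. *)
Definition sgl x a : E :=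
  [ffun m => if m == expo_mod pp a then x * mon B (expo_div p a) else 0].

Lemma sglD a : {morph sgl^~ a : x y / x + y}.
Proof.
move=> x y; apply/ffunP=> m; rewrite !ffunE.
by case: eqP; rewrite ?addr0 // mulrDl.
Qed.

Lemma sgl0 a : sgl 0 a = 0.
Proof. by apply/ffunP=> m; rewrite !ffunE mul0r if_same. Qed.

Lemma sgl_mon x a b : sgl (x * mon B b) a = sgl x (expo_add a (expo_mul p b)).
Proof.
apply/ffunP=> m; rewrite !ffunE expo_mod_addmul expo_div_addmul //.
by rewrite monD -mulrA [mon B b * _]mulrC.
Qed.

Lemma ext_sum u : u = \sum_k sgl (u k) (expo_val k).
Proof.
apply/ffunP=> m; rewrite sum_ffunE (bigD1 m) //= big1 => [|k km].
  by rewrite !ffunE expo_modK eqxx expo_div_val mon0 mulr1 addr0.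
by rewrite ffunE expo_modK eq_sym (negPf km).
Qed.

Lemma ext_ind (P : E -> Prop) :
  P 0 -> (forall u v, P u -> P v -> P (u + v)) -> (forall x a, P (sgl x a)) ->
  forall u, P u.
Proof.
by move=> P0 PD Ps u; rewrite [u]ext_sum; elim/big_ind: _ => // k _; apply: Ps.
Qed.

Definition ext_mul u v : E :=
  \sum_k \sum_l sgl (u k * v l) (expo_add (expo_val k) (expo_val l)).

Lemma ext_mul_sgl x a y b : ext_mul (sgl x a) (sgl y b) = sgl (x * y) (expo_add a b).
Proof.
rewrite /ext_mul (bigD1 (expo_mod pp a)) //= (bigD1 (expo_mod pp b)) //=.
rewrite [X in _ + X]big1 ?addr0 => [|k ka]; last first.
  by apply: big1 => l _; rewrite ffunE (negPf ka) mul0r sgl0.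
rewrite [X in _ + X]big1 ?addr0 => [|l lb]; last first.
  by rewrite [sgl y b l]ffunE (negPf lb) mulr0 sgl0.
rewrite !ffunE !eqxx mulrACA -monD sgl_mon; congr sgl.
apply/ffunP=> i; rewrite !ffunE /= mulnDr !(mulnC p).
by rewrite addnACA !(addnC (_ %% _)%N) -!divn_eq.
Qed.

Lemma ext_mulDl : left_distributive ext_mul +%R.
Proof.
move=> u v w; rewrite /ext_mul -big_split; apply: eq_bigr => k _ /=.
by rewrite -big_split; apply: eq_bigr => l _; rewrite ffunE mulrDl sglD.
Qed.

Lemma ext_mulC : commutative ext_mul.
Proof.
move=> u v; rewrite /ext_mul exchange_big; apply: eq_bigr => k _ /=.
by apply: eq_bigr => l _; rewrite mulrC expo_addC.
Qed.

Lemma ext_mulDr : right_distributive ext_mul +%R.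
Proof. by move=> u v w; rewrite !(ext_mulC u) ext_mulDl. Qed.

Lemma ext_mul0l u : ext_mul 0 u = 0.
Proof. by apply: (addIr (ext_mul 0 u)); rewrite -ext_mulDl !add0r. Qed.

Lemma ext_mulA : associative ext_mul.
Proof.
have mul0r := ext_mul0l; have mulr0 u : ext_mul u 0 = 0 by rewrite ext_mulC mul0r.
move=> u v w; elim/ext_ind: u => [|u u' IHu IHu'|x a]; rewrite ?mul0r //.
  by rewrite !ext_mulDl IHu IHu'.
elim/ext_ind: v => [|v v' IHv IHv'|y b]; rewrite ?(mul0r, mulr0) //.
  by rewrite !(ext_mulDl, ext_mulDr) IHv IHv'.
elim/ext_ind: w => [|w w' IHw IHw'|z c]; rewrite ?(mul0r, mulr0) //.
  by rewrite !ext_mulDr IHw IHw'.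
by rewrite !ext_mul_sgl mulrA expo_addA.
Qed.

Lemma ext_mul1 : left_id (sgl 1 (expo0 I)) ext_mul.
Proof.
elim/ext_ind=> [|u v IHu IHv|x a]; first by rewrite ext_mulC ext_mul0l.
  by rewrite ext_mulDr IHu IHv.
by rewrite ext_mul_sgl mul1r expo_add0.
Qed.

HB.instance Definition _ := GRing.Zmodule_isComPzRing.Build (ext pp B)
  ext_mulA ext_mulC ext_mul1 ext_mulDl.

Lemma sgl_mul x a y b : sgl x a * sgl y b = sgl (x * y) (expo_add a b).
Proof. exact: ext_mul_sgl. Qed.

Lemma sgl_exp x a n : sgl x a ^+ n = sgl (x ^+ n) [ffun i => (n * a i)%N].
Proof.
elim: n => [|n IHn].
  rewrite !expr0 -[LHS]/(sgl 1 (expo0 I)).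
  by congr sgl; apply/ffunP=> i; rewrite !ffunE.
rewrite !exprS IHn sgl_mul; congr sgl; apply/ffunP=> i.
by rewrite !ffunE mulSn.
Qed.

Lemma ext_char : is_Fp_algebra p E.
Proof.
rewrite /is_Fp_algebra pp -[1]/(sgl 1 (expo0 I)) /=.
have -> : sgl 1 (expo0 I) *+ p = sgl (1 *+ p) (expo0 I).
  by elim: (X in _ *+ X = sgl (_ *+ X) _) => [|n IHn]; rewrite ?mulr0n ?sgl0 // !mulrS sglD IHn.
by have /andP[_ /eqP->] := pr_char B; rewrite sgl0.
Qed.

Fact ext_mon0 : sgl 1 (expo0 I) = 1. Proof. by []. Qed.
Fact ext_monD a b : sgl 1 (expo_add a b) = sgl 1 a * sgl 1 b.
Proof. by rewrite sgl_mul mulr1. Qed.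

Definition extP : pring p I := PRing ext_char ext_mon0 ext_monD.

(* The Frobenius of B relative to F_p[z_i]; it is bijective if and only if the
   z_i form a p-basis of B, and surjective if and only if the monomials in the
   z_i span B over B^p. *)
Definition rfrob (u : E) : B := \sum_k u k ^+ p * mon B (expo_val k).

Lemma frobD x y : (x + y) ^+ p = x ^+ p + y ^+ p.
Proof. exact: (raddfD (Frobenius (pr_char B))). Qed.
Lemma frob0 : 0 ^+ p = 0 :> B.
Proof. exact: (raddf0 (Frobenius (pr_char B))). Qed.

Lemma rfrob_sgl x a : rfrob (sgl x a) = x ^+ p * mon B a.
Proof.
rewrite /rfrob (bigD1 (expo_mod pp a)) //= big1 => [|k ka]; last first.
  by rewrite ffunE (negPf ka) frob0 mul0r.
rewrite ffunE eqxx addr0 exprMn -mon_exp -mulrA -monD; congr (_ * mon B _).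
exact: expo_divmod.
Qed.

Fact rfrob_nmod_morphism : nmod_morphism rfrob.
Proof.
split=> [|u v]; first by apply: big1 => k _; rewrite ffunE frob0 mul0r.
by rewrite /rfrob -big_split; apply: eq_bigr => k _; rewrite ffunE frobD mulrDl.
Qed.
HB.instance Definition _ := GRing.isNmodMorphism.Build E B rfrob rfrob_nmod_morphism.

Fact rfrob_monoid_morphism : monoid_morphism rfrob.
Proof.
split=> [|u v]; first by rewrite rfrob_sgl expr1n mon0 mulr1.
elim/ext_ind: u => [|u u' IHu IHu'|x a].
- by rewrite mul0r !raddf0 mul0r.
- by rewrite mulrDl !raddfD /= IHu IHu' mulrDl.
elim/ext_ind: v => [|v v' IHv IHv'|y b].
- by rewrite mulr0 !raddf0 mulr0.
- by rewrite mulrDr !raddfD /= IHv IHv' mulrDr.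
by rewrite sgl_mul !rfrob_sgl exprMn monD mulrACA.
Qed.
HB.instance Definition _ :=
  GRing.isMonoidMorphism.Build E B rfrob rfrob_monoid_morphism.

End ExtRing.

(** Since [X_i^p = z_i], the [p]-th power of [sum u_k X^k] is the constant [sum u_k^p z^k]. *)
Lemma ext_frob B (u : ext pp B) : u ^+ p = sgl (rfrob u) (expo0 I).
Proof.
elim/ext_ind: u => [|u v IHu IHv|x a].
- by rewrite (frob0 (extP B)) raddf0 sgl0.
- by rewrite (frobD (B := extP B)) IHu IHv raddfD sglD.
rewrite sgl_exp rfrob_sgl sgl_mon.
by congr sgl; apply/ffunP=> i; rewrite !ffunE.
Qed.

Lemma ext_frob_sum B (F : K -> ext pp B) (m : K) :
  (\sum_k F k ^+ p * sgl 1 (expo_val k)) m = rfrob (F m).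
Proof.
pose u : ext pp B := [ffun k => rfrob (F k)].
suff -> : \sum_k F k ^+ p * sgl 1 (expo_val k) = u by rewrite ffunE.
rewrite [RHS]ext_sum; apply: eq_bigr => k _.
by rewrite ext_frob sgl_mul mulr1 expo_add0 ffunE.
Qed.

(** In the tower, each transition map therefore acts on coefficients by the preceding one:
    surjectivity climbs the tower, and the coefficients of a compatible family are compatible. *)
Lemma rfrob_ext B (u : ext pp (extP B)) (m : K) :
  rfrob u m = rfrob (u m).
Proof. exact: ext_frob_sum. Qed.

End Ext.

(** * The limit of the tower *)

Section Tower.
Variables (p : nat) (pp : prime p) (I : finType).
Local Notation K := {ffun I -> 'I_p}.
Local Notation N := {ffun I -> nat}.

Fixpoint tow (B : pring p I) e : pring p I :=
  if e is e'.+1 then extP pp (tow B e') else B.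

Definition tow_trans B e : {rmorphism tow B e.+1 -> tow B e} :=
  @rfrob p pp I (tow B e).

Lemma tow_trans_mon B e a : tow_trans B e (mon _ a) = mon _ a.
Proof. by rewrite [LHS]rfrob_sgl expr1n mul1r. Qed.

Record lim (B : pring p I) := Lim {
  lv : forall e, tow B e;
  lvP : forall e, tow_trans B e (lv e.+1) = lv e }.

Section LimRing.
Variable B : pring p I.
Implicit Types x y z : lim B.

Lemma lim_eq x y : (forall e, lv x e = lv y e) -> x = y.
Proof.
case: x y => [x xP] [y yP] /= xy.
have E : x = y by apply: functional_extensionality_dep.
by case: y / E yP xy => yP _; congr Lim; apply: Prop_irrelevance.
Qed.

HB.instance Definition _ := gen_eqMixin (lim B).
HB.instance Definition _ := gen_choiceMixin (lim B).

Definition lim0 : lim B := @Lim B (fun e => 0) (fun e => raddf0 (tow_trans B e)).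
Definition lim1 : lim B := @Lim B (fun e => 1) (fun e => rmorph1 (tow_trans B e)).

Fact lim_addP x y e : tow_trans B e (lv x e.+1 + lv y e.+1) = lv x e + lv y e.
Proof. by rewrite rmorphD !lvP. Qed.
Definition lim_add x y : lim B := Lim (lim_addP x y).

Fact lim_oppP x e : tow_trans B e (- lv x e.+1) = - lv x e.
Proof. by rewrite rmorphN lvP. Qed.
Definition lim_opp x : lim B := Lim (lim_oppP x).

Fact lim_mulP x y e : tow_trans B e (lv x e.+1 * lv y e.+1) = lv x e * lv y e.
Proof. by rewrite rmorphM !lvP. Qed.
Definition lim_mul x y : lim B := Lim (lim_mulP x y).

Fact lim_addA : associative lim_add.
Proof. by move=> x y z; apply: lim_eq => e; apply: addrA. Qed.
Fact lim_addC : commutative lim_add.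
Proof. by move=> x y; apply: lim_eq => e; apply: addrC. Qed.
Fact lim_add0 : left_id lim0 lim_add.
Proof. by move=> x; apply: lim_eq => e; apply: add0r. Qed.
Fact lim_addN : left_inverse lim0 lim_opp lim_add.
Proof. by move=> x; apply: lim_eq => e; apply: addNr. Qed.
HB.instance Definition _ :=
  GRing.isZmodule.Build (lim B) lim_addA lim_addC lim_add0 lim_addN.

Fact lim_mulA : associative lim_mul.
Proof. by move=> x y z; apply: lim_eq => e; apply: mulrA. Qed.
Fact lim_mulC : commutative lim_mul.
Proof. by move=> x y; apply: lim_eq => e; apply: mulrC. Qed.
Fact lim_mul1 : left_id lim1 lim_mul.
Proof. by move=> x; apply: lim_eq => e; apply: mul1r. Qed.
Fact lim_mulDl : left_distributive lim_mul +%R.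
Proof. by move=> x y z; apply: lim_eq => e; apply: mulrDl. Qed.
HB.instance Definition _ := GRing.Zmodule_isComPzRing.Build (lim B)
  lim_mulA lim_mulC lim_mul1 lim_mulDl.

Definition lev e (x : lim B) : tow B e := lv x e.
Fact lev_nmod_morphism e : nmod_morphism (lev e). Proof. by []. Qed.
Fact lev_monoid_morphism e : monoid_morphism (lev e). Proof. by []. Qed.
HB.instance Definition _ e :=
  GRing.isNmodMorphism.Build (lim B) (tow B e) (lev e) (lev_nmod_morphism e).
HB.instance Definition _ e :=
  GRing.isMonoidMorphism.Build (lim B) (tow B e) (lev e) (lev_monoid_morphism e).

Lemma lev_eq x y : (forall e, lev e x = lev e y) -> x = y.
Proof. exact: lim_eq. Qed.
Lemma lev_trans e x : tow_trans B e (lev e.+1 x) = lev e x.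
Proof. exact: lvP. Qed.

Definition lim_mon a : lim B := Lim (fun e => tow_trans_mon B e a).

Fact lim_char : is_Fp_algebra p (lim B).
Proof.
rewrite /is_Fp_algebra pp /=; apply/eqP; apply: lev_eq => e.
by rewrite rmorph_nat rmorph0; have /andP[_ /eqP] := pr_char (tow B e).
Qed.
Fact lim_mon0 : lim_mon (expo0 I) = 1.
Proof. by apply: lev_eq => e; apply: mon0. Qed.
Fact lim_monD a b : lim_mon (expo_add a b) = lim_mon a * lim_mon b.
Proof. by apply: lev_eq => e; apply: monD. Qed.

Definition limP : pring p I := PRing lim_char lim_mon0 lim_monD.

Fact lim_coefP x k e :
  tow_trans B e ((lev e.+2 x : ext pp (tow B e.+1)) k) =
    (lev e.+1 x : ext pp (tow B e)) k.
Proof. by rewrite -(lev_trans e.+1 x); apply/esym/rfrob_ext. Qed.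
(** Coefficients at level [e.+1] live at level [e], so reading them off shifts the tower by one.
    They are the coordinates [x_k] in [x = sum x_k^p z^k]. *)
Definition lim_coef x k : lim B := Lim (lim_coefP x k).

Lemma lev_rfrob e (u : ext pp limP) :
  lev e (rfrob u) = \sum_k lev e (u k) ^+ p * mon (tow B e) (expo_val k).
Proof. by rewrite rmorph_sum; apply: eq_bigr => k _; rewrite rmorphM rmorphXn. Qed.

Lemma lim_coefK : cancel (rfrob (B := limP) : ext pp limP -> limP)
  (fun x => [ffun k => lim_coef x k] : ext pp limP).
Proof.
move=> u; apply/ffunP=> m; rewrite ffunE; apply: lev_eq => e.
rewrite -[LHS]/((lev e.+1 (rfrob (u : ext pp limP)) : ext pp (tow B e)) m).
by rewrite lev_rfrob -(lev_trans e); apply: ext_frob_sum.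
Qed.

Lemma lim_coefE (x : lim B) : rfrob ([ffun k => lim_coef x k] : ext pp limP) = x.
Proof.
apply: lev_eq => e; rewrite lev_rfrob -[RHS]lev_trans; apply: eq_bigr => k _.
by rewrite ffunE.
Qed.

Lemma rfrob_lim_bij : bijective (rfrob (B := limP) : ext pp limP -> limP).
Proof. exact: Bijective lim_coefK lim_coefE. Qed.

(** Completeness for the kernels of the [lev e]; the limit is the diagonal [e |-> lev e (s e)]. *)
Lemma lim_limit (s : nat -> lim B) :
    (forall e, lev e (s e.+1) = lev e (s e)) ->
  exists x, forall e, lev e x = lev e (s e).
Proof.
move=> cs; have sP e : tow_trans B e (lev e.+1 (s e.+1)) = lev e (s e).
  by rewrite lev_trans cs.
by exists (Lim sP).
Qed.

Hypothesis surjB : surjective (rfrob (B := B) : ext pp B -> B).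

Lemma tow_trans_surj e : surjective (tow_trans B e).
Proof.
elim: e => [|e IHe]; first exact: surjB.
move=> u; have /choice[v vE] := fun k => IHe ((u : ext pp (tow B e)) k).
exists ([ffun k => v k] : ext pp (tow B e.+1)).
by apply/ffunP=> k; rewrite rfrob_ext ffunE vE.
Qed.

Lemma lev0_surj : surjective (lev 0).
Proof.
move=> b; have /(_ _)/choice sec e := tow_trans_surj (e := e).
pose s := fix s e : tow B e :=
  if e is e'.+1 then projT1 (sec e') (s e') else b.
have sP e : tow_trans B e (s e.+1) = s e by apply: (projT2 (sec e)).
by exists (Lim sP).
Qed.

End LimRing.

Record phom (A B : pring p I) := PHom {
  phom_fun :> {rmorphism pr_car A -> pr_car B};
  phom_mon : forall a : N, phom_fun (mon A a) = mon B a }.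

Section Functoriality.
Variables (A B : pring p I).

Section ExtMap.
Variables (A' B' : pring p I) (f : phom A' B').
Definition ext_map (u : ext pp A') : ext pp B' := [ffun k => f (u k)].

Lemma ext_map_sgl x a : ext_map (sgl pp x a) = sgl pp (f x) a.
Proof.
apply/ffunP=> m; rewrite !ffunE; case: eqP; rewrite ?rmorph0 //.
by rewrite rmorphM phom_mon.
Qed.

Fact ext_map_nmod_morphism : nmod_morphism ext_map.
Proof.
by split=> [|u v]; apply/ffunP=> k; rewrite !ffunE ?rmorph0 ?rmorphD.
Qed.
HB.instance Definition _ :=
  GRing.isNmodMorphism.Build (ext pp A') (ext pp B') ext_map ext_map_nmod_morphism.

Fact ext_map_monoid_morphism : monoid_morphism ext_map.
Proof.
split=> [|u v]; first by rewrite ext_map_sgl rmorph1.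
elim/ext_ind: u => [|u u' IHu IHu'|x a].
- by rewrite mul0r !raddf0 mul0r.
- by rewrite mulrDl !raddfD /= IHu IHu' mulrDl.
elim/ext_ind: v => [|v v' IHv IHv'|y b].
- by rewrite mulr0 !raddf0 mulr0.
- by rewrite mulrDr !raddfD /= IHv IHv' mulrDr.
by rewrite sgl_mul !ext_map_sgl sgl_mul rmorphM.
Qed.
HB.instance Definition _ := GRing.isMonoidMorphism.Build
  (ext pp A') (ext pp B') ext_map ext_map_monoid_morphism.

Fact ext_map_mon a : ext_map (mon (extP pp A') a) = mon (extP pp B') a.
Proof. by rewrite [LHS]ext_map_sgl rmorph1. Qed.
Definition extM : phom (extP pp A') (extP pp B') :=
  @PHom (extP pp A') (extP pp B') ext_map ext_map_mon.

Lemma rfrob_ext_map u : rfrob (extM u) = f (rfrob u).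
Proof.
rewrite rmorph_sum; apply: eq_bigr => k _.
by rewrite ffunE rmorphM rmorphXn phom_mon.
Qed.

End ExtMap.

Variable f : phom A B.
Fixpoint towM e : phom (tow A e) (tow B e) :=
  if e is e'.+1 then extM (towM e') else f.

Fact lim_mapP (x : lim A) e : tow_trans B e (towM e.+1 (lev e.+1 x)) = towM e (lev e x).
Proof. by rewrite -(lev_trans e x); apply: rfrob_ext_map. Qed.
Definition lim_map (x : lim A) : lim B := Lim (lim_mapP x).

Fact lim_map_nmod_morphism : nmod_morphism lim_map.
Proof. by split=> [|x y]; apply: lim_eq => e /=; rewrite ?rmorph0 ?rmorphD. Qed.
Fact lim_map_monoid_morphism : monoid_morphism lim_map.
Proof. by split=> [|x y]; apply: lim_eq => e /=; rewrite ?rmorph1 ?rmorphM. Qed.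
HB.instance Definition _ :=
  GRing.isNmodMorphism.Build (lim A) (lim B) lim_map lim_map_nmod_morphism.
HB.instance Definition _ :=
  GRing.isMonoidMorphism.Build (lim A) (lim B) lim_map lim_map_monoid_morphism.

Fact lim_map_mon a : lim_map (mon (limP A) a) = mon (limP B) a.
Proof. by apply: lim_eq => e; apply: phom_mon. Qed.
Definition limM : phom (limP A) (limP B) := @PHom (limP A) (limP B) lim_map lim_map_mon.

Lemma lev0_limM x : lev 0 (limM x) = f (lev 0 x).
Proof. by []. Qed.

End Functoriality.
End Tower.

Arguments lev {p pp I B} e x : simpl never.
Arguments lim_coef {p pp I B} x k : simpl never.

(** * Noetherianity of the limit *)

Lemma fg_ideal_row (A : comPzRingType) (J : A -> Prop) r1 r2 (l1 : 'rV_r1) (l2 : 'rV_r2) :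
    is_ideal J -> (forall t, J (l1 0 t)) -> (forall t, J (l2 0 t)) ->
    (forall x, J x -> exists (u1 : 'cV_r1) (u2 : 'cV_r2), x = (l1 *m u1) 0 0 + (l2 *m u2) 0 0) ->
  fg_ideal J.
Proof.
move=> idJ Jl1 Jl2 gl; apply/(fg_idealP idJ).
exists (r1 + r2)%N, (row_mx l1 l2); split=> [t|x /gl[u1 [u2 ->]]].
  by rewrite mxE; case: (split t) => k; [apply: Jl1|apply: Jl2].
by exists (col_mx u1 u2); rewrite mul_row_col [RHS]mxE.
Qed.

Lemma frob_sum (p : nat) (I : finType) (B : pring p I) (J : finType) (F : J -> B) :
  (\sum_j F j) ^+ p = \sum_j F j ^+ p.
Proof. exact: (raddf_sum (Frobenius (pr_char B))). Qed.

Lemma rfrob_lin (p : nat) (pp : prime p) (I : finType) (B : pring p I) (r : nat)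
    (y : {ffun I -> 'I_p} -> 'I_r -> B) (c : 'I_r -> B) :
  rfrob ([ffun k => \sum_t c t * y k t] : ext pp B) =
  \sum_t c t ^+ p * rfrob ([ffun k => y k t] : ext pp B).
Proof.
under [RHS]eq_bigr => t _ do rewrite mulr_sumr.
rewrite exchange_big; apply: eq_bigr => k _.
rewrite ffunE frob_sum mulr_suml; apply: eq_bigr => t _.
by rewrite ffunE exprMn mulrA.
Qed.

Section LimNoetherian.
Variables (p : nat) (pp : prime p) (I : finType) (B : pring p I).
Hypothesis surjB : surjective (rfrob (B := B) : ext pp B -> B).
Hypothesis noethB : noetherian B.
Local Notation K := {ffun I -> 'I_p}.
Local Notation D := (lim pp B).
Local Notation lev := (@lev p pp I B).

Lemma lev_succ e x : lev e.+1 x = 0 -> lev e x = 0.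
Proof. by rewrite -(lev_trans e) => ->; rewrite rmorph0. Qed.

Lemma lev_pred e x : lev e x = 0 -> lev e.-1 x = 0.
Proof. by case: e => // e /lev_succ. Qed.

(** An element vanishes at level [e.+1] as soon as its coordinates vanish at level [e]. Hence the
    kernel of [lev e.+1] is generated by the [p]-th powers of the kernel of [lev e], which drives
    the approximations below. *)
Lemma lev_rfrob_eq0 e (u : ext pp (limP pp B)) :
  (forall k, lev e (u k) = 0) -> lev e.+1 (rfrob u) = 0.
Proof.
move=> u0; apply/ffunP=> k.
have /ffunP/(_ k) := lim_coefK u; rewrite !ffunE => uE.
by rewrite -[LHS]/(lev e (lim_coef (rfrob u) k)) uE.
Qed.

Lemma lev_pow e x : lev 0 x = 0 -> lev e (x ^+ (p ^ e)) = 0.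
Proof.
elim: e => // e IHe /IHe x0.
rewrite expnSr exprM rmorphXn ext_frob.
by rewrite -[rfrob _]/(tow_trans pp B e _) lev_trans x0 sgl0.
Qed.

Lemma kernel_gens_mod_Frobenius : exists r (j : 'I_r -> D),
  (forall t, lev 0 (j t) = 0) /\
  forall x, lev 0 x = 0 -> exists y : 'I_r -> D,
    lev 1 (x - \sum_t y t * j t) = 0.
Proof.
pose vec (v : 'cV[B]_#|K|) : ext pp B := [ffun k => v (enum_rank k) 0].
have vecD v w : vec (v + w) = vec v + vec w by apply/ffunP=> k; rewrite !(ffunE, mxE).
have vecZ a v : rfrob (vec (a *: v)) = a ^+ p * rfrob (vec v).
  rewrite mulr_sumr; apply: eq_bigr => k _.
  by rewrite !(ffunE, mxE) exprMn mulrA.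
have [|r [l gl]] := @noetherian_submodule _ _ (fun v => rfrob (vec v) = 0) noethB.
  split=> [|v w v0 w0|a v v0].
  - by rewrite -[RHS](raddf0 (@rfrob p pp I B)); congr rfrob; apply/ffunP=> k; rewrite !(ffunE, mxE).
  - by rewrite vecD raddfD /= v0 w0 addr0.
  - by rewrite vecZ v0 mulr0.
have /choice[lift liftE] := lev0_surj surjB.
pose j t : D := rfrob ([ffun k => lift (l (enum_rank k) t)] : ext pp (limP pp B)).
exists r, j; split=> [t|x x0].
  have /= <- := generates_col t gl; rewrite /j lev_rfrob; apply: eq_bigr => k _.
  by rewrite !(ffunE, mxE) liftE.
have [u uE] : exists u, \col_i lev 0 (lim_coef x (enum_val i)) = l *m u.
  apply/gl; rewrite -[RHS]x0 -[in RHS](lim_coefE x) lev_rfrob.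
  by apply: eq_bigr => k _; rewrite !(ffunE, mxE) enum_rankK.
(* Scaling the coordinates by [u t] scales the element by the [p]-th power. *)
exists (fun t => lift (u t 0) ^+ p).
have -> : x - \sum_t lift (u t 0) ^+ p * j t =
    rfrob ([ffun k => lim_coef x k] - [ffun k => \sum_t lift (u t 0) * lift (l (enum_rank k) t)]
      : ext pp (limP pp B)).
  by rewrite raddfB /= lim_coefE (@rfrob_lin _ _ _ (limP pp B)).
apply: lev_rfrob_eq0 => k; rewrite !ffunE raddfB raddf_sum /=.
have /matrixP/(_ (enum_rank k) 0) := uE; rewrite !mxE enum_rankK => ->.
apply/eqP; rewrite subr_eq0; apply/eqP; apply: eq_bigr => t _.
by rewrite rmorphM /= !liftE mulrC.
Qed.

(* Successive approximation; in the step e = 0 nothing is required of y. *)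
Lemma lim_nakayama r (a : 'I_r -> D) (X : nat -> D -> Prop) :
    (forall e x, X e x -> lev e.-1 x = 0) ->
    (forall e x, X e x -> exists y : 'I_r -> D,
       (forall t, (0 < e)%N -> lev e.-1 (y t) = 0) /\ X e.+1 (x - \sum_t y t * a t)) ->
  forall x, X 0%N x -> exists y : 'I_r -> D, x = \sum_t y t * a t.
Proof.
move=> X0 Xstep x Xx.
have /choice[Y YP] : forall ex : nat * D, exists y : 'I_r -> D, X ex.1 ex.2 ->
    (forall t, (0 < ex.1)%N -> lev ex.1.-1 (y t) = 0) /\
    X ex.1.+1 (ex.2 - \sum_t y t * a t).
  move=> [e z]; have [/Xstep[y yP]|nX] := pselect (X e z); first by exists y.
  by exists (fun=> 0) => /nX.
pose xs := fix xs e := if e is e'.+1 then xs e' - \sum_t Y (e', xs e') t * a t else x.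
have Xxs e : X e (xs e) by elim: e => //= e /(YP (e, xs e))[].
pose s t N := \sum_(e < N.+1) Y (e : nat, xs e) t.
have sE N : x - \sum_t s t N * a t = xs N.+1.
  elim: N => [|N IHN].
    by rewrite /=; congr (_ - _); apply: eq_bigr => t _; rewrite /s big_ord1.
  rewrite -[RHS]/(xs N.+1 - \sum_t Y (N.+1, xs N.+1) t * a t) -{1}IHN.
  rewrite -addrA -opprD -big_split; congr (_ - _); apply: eq_bigr => t _.
  by rewrite /s big_ord_recr mulrDl.
have /choice[y yP] : forall t, exists y, forall e, lev e y = lev e (s t e).
  move=> t; apply: lim_limit => e; rewrite /s [in LHS]big_ord_recr raddfD /=.
  by have [/(_ t isT)/= -> _] := YP (e.+1, xs e.+1) (Xxs _); rewrite addr0.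
exists y; apply/eqP; rewrite -subr_eq0; apply/eqP; apply: lev_eq => e.
rewrite raddf0 -(X0 _ _ (Xxs e.+1)) -(sE e) [e.+1.-1]/= !raddfB !raddf_sum /=.
by congr (_ + _); apply: eq_bigr => t _; rewrite !rmorphM /= yP.
Qed.

Lemma kernel_lev0_fg : fg_ideal (fun x => lev 0 x = 0).
Proof.
have [r [j [j0 jgen]]] := kernel_gens_mod_Frobenius.
(* The case [e = 0] is applied to iterated coordinates; each return from coordinates to elements
   raises the [j t] to the power [p]. *)
have step e x : lev e x = 0 ->
    exists y : 'I_r -> D, lev e.+1 (x - \sum_t y t * j t ^+ (p ^ e)) = 0.
  elim: e x => [|e IHe] x x0; first exact: jgen.
  have /choice[y yP] : forall k, exists y : 'I_r -> D,
      lev e.+1 (lim_coef x k - \sum_t y t * j t ^+ (p ^ e)) = 0.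
    by move=> k; apply: IHe; rewrite -[LHS]/((lev e.+1 x : ext pp (tow pp B e)) k) x0 ffunE.
  exists (fun t => rfrob ([ffun k => y k t] : ext pp (limP pp B))).
  have -> : x - \sum_t rfrob ([ffun k => y k t] : ext pp (limP pp B)) * j t ^+ (p ^ e.+1) =
      rfrob ([ffun k => lim_coef x k] - [ffun k => \sum_t j t ^+ (p ^ e) * y k t]
      : ext pp (limP pp B)).
    rewrite raddfB /= lim_coefE (@rfrob_lin _ _ _ (limP pp B)).
    by congr (_ - _); apply: eq_bigr => t _; rewrite mulrC expnSr exprM.
  apply: lev_rfrob_eq0 => k; rewrite !ffunE -[RHS](yP k); congr (lev _ (_ - _)).
  by apply: eq_bigr => t _; rewrite mulrC.
apply/fg_idealP.
  split=> [|x y x0 y0|a x x0]; first exact: raddf0.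
    by rewrite raddfD /= x0 y0 addr0.
  by rewrite rmorphM /= x0 mulr0.
exists r, (\row_t j t); split=> [t|x x0]; first by rewrite mxE.
have [||y ->] := @lim_nakayama r j (fun e x => lev e x = 0) _ _ x x0.
- by move=> e z; apply: lev_pred.
(* One factor [j t] serves as generator, the other [p ^ e - 1] make the coefficient small. For
   [e > 0] this number is at least [p ^ (e - 1)], so the coefficient vanishes at level [e.-1],
   though perhaps not at level [e]. *)
- move=> e z /step[y yP]; exists (fun t => y t * j t ^+ (p ^ e).-1); split=> [t|].
    case: e {yP} => // e _ /=; rewrite rmorphM.
    have -> : (p ^ e.+1).-1 = ((p ^ e.+1).-1 - p ^ e + p ^ e)%N.
      rewrite subnK // -ltnS prednK ?expn_gt0 ?prime_gt0 //.
      by rewrite ltn_exp2l ?prime_gt1.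
    by rewrite exprD rmorphM /= lev_pow ?mulr0.
  rewrite -[RHS]yP; congr (lev _ (_ - _)); apply: eq_bigr => t _.
  by rewrite -mulrA -exprSr prednK // expn_gt0 prime_gt0.
- exists (\col_t y t); rewrite mxE; apply: eq_bigr => t _.
  by rewrite !mxE mulrC.
Qed.

Lemma lim_noetherian : noetherian D.
Proof.
apply/noetherianP; apply: ideal_ind => // J idJ IH.
case: (idJ) => J0 JD JM.
(* If [J] contains the kernel of [lev 0], its generators come from that kernel and from the image of
   [J] in [B]. Otherwise some [j] of the kernel lies outside [J], and its powers tend to 0. *)
have [IJ|nIJ] := pselect (forall x, lev 0 x = 0 -> J x).
  have [|r [l lP]] := (noetherianP B).1 noethB (fun b => exists2 x, J x & lev 0 x = b).
    split=> [|_ _ [x Jx <-] [y Jy <-]|b _ [x Jx <-]].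
    - by exists 0; rewrite ?raddf0.
    - by exists (x + y); rewrite ?raddfD //; apply: JD.
    - have [a <-] := lev0_surj surjB b.
      by exists (a * x); rewrite ?rmorphM //; apply: JM.
  have [r' [l' l'P]] := kernel_lev0_fg.
  have /choice[g gP] : forall t, exists x, J x /\ lev 0 x = l 0 t.
    by move=> t; have [x Jx xE] := fg_ideal_gen t lP; exists x.
  apply: (@fg_ideal_row _ J _ _ (\row_t g t) l') => // [t|t|x Jx].
  - by rewrite mxE; case: (gP t).
  - by apply: IJ; apply: (fg_ideal_gen t l'P).
  have [|u uE] := (lP (lev 0 x)).1; first by exists x.
  have /choice[v vE] := fun t => lev0_surj surjB (u t 0).
  have [|u' u'E] := (l'P (x - (\row_t g t *m \col_t v t) 0 0)).1.
    rewrite raddfB /= uE !mxE raddf_sum /= -sumrB; apply: big1 => t _.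
    by rewrite !mxE rmorphM /= vE; case: (gP t) => _ ->; rewrite subrr.
  by exists (\col_t v t), u'; rewrite -u'E subrKC.
have [j j0 nJj] : exists2 j, lev 0 j = 0 & ~ J j.
  by apply: contrapT => no; apply: nIJ => x x0; apply: contrapT => nJx; apply: no; exists x.
have [|x Jx||r [l lP]] := IH (fun x => exists a b, J a /\ x = a + b * j).
- split=> [|_ _ [a [b [Ja ->]]] [a' [b' [Ja' ->]]]|c _ [a [b [Ja ->]]]].
  + by exists 0, 0; rewrite mul0r addr0.
  + by exists (a + a'), (b + b'); rewrite mulrDl addrACA; split=> //; apply: JD.
  + by exists (c * a), (c * b); rewrite mulrDr mulrA; split=> //; apply: JM.
- by exists x, 0; rewrite mul0r addr0.
- by exists j; split=> //; exists 0, 1; rewrite mul1r add0r.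
have /choice[g gP] : forall t, exists ab : D * D, J ab.1 /\ l 0 t = ab.1 + ab.2 * j.
  by move=> t; have [a [b ?]] := fg_ideal_gen t lP; exists (a, b).
have Jg t : J ((\row_t (g t).1) 0 t) by rewrite mxE; case: (gP t).
(* [J + (j)] is finitely generated; with [g] the components in [J] of its generators,
   [J = (g) + j (J : j)]. *)
have gen x : J x -> exists (u : 'cV_r) c, J (j * c) /\ x = (\row_t (g t).1 *m u) 0 0 + c * j.
  move=> Jx; have [|u uE] := (lP x).1; first by exists x, 0; rewrite mul0r addr0.
  have xE : x = (\row_t (g t).1 *m u) 0 0 + (\row_t (g t).2 *m u) 0 0 * j.
    rewrite uE !mxE mulr_suml -big_split; apply: eq_bigr => t _ /=.
    by rewrite !mxE; case: (gP t) => _ ->; rewrite mulrDl mulrAC.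
  exists u, ((\row_t (g t).2 *m u) 0 0); split=> //.
  have -> : j * (\row_t (g t).2 *m u) 0 0 = x + (-1) * (\row_t (g t).1 *m u) 0 0.
    by rewrite xE mulN1r addrC addKr mulrC.
  by apply: JD => //; apply: JM; apply: ideal_mulmx.
have idQ : is_ideal (fun c => J (j * c)).
  split=> [|x y Jx Jy|a x Jx]; first by rewrite mulr0.
    by rewrite mulrDr; apply: JD.
  by rewrite mulrCA; apply: JM.
(* If [(J : j)] is strictly larger than [J], it is finitely generated, hence so is [J]. Otherwise
   [J = (g) + j J], which iterates to [J = (g) + j^N J], and completeness finishes. *)
have [bigger|same] := pselect (exists x, J (j * x) /\ ~ J x).
  have [x Jx|r' [l' l'P]] := IH _ idQ _ bigger; first exact: JM.
  apply: (fg_ideal_row idJ Jg (l2 := j *: l')) => [t|x /gen[u [c [/l'P[u' cE] ->]]]].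
    by rewrite mxE; apply: (fg_ideal_gen t l'P).
  exists u, u'; rewrite -scalemxAl; congr (_ + _).
  by rewrite [RHS]mxE -cE mulrC.
have genN N x : J x -> exists (u : 'cV_r) c, J c /\ x = (\row_t (g t).1 *m u) 0 0 + c * j ^+ N.
  elim: N x => [|N IHN] x Jx.
    by exists 0, x; rewrite mulr1 mulmx0 mxE add0r.
  have [u [c [Jc ->]]] := IHN x Jx; have [u' [c' [Jc' ->]]] := gen c Jc.
  exists (u + j ^+ N *: u'), c'; split.
    by apply: contrapT => nJ; apply: same; exists c'.
  rewrite mulmxDr -scalemxAr [in RHS]mxE -addrA; congr (_ + _).
  by rewrite [X in _ = X + _]mxE mulrDl -mulrA -exprS [_ * j ^+ N]mulrC.
(* One division by [j] comes first, because the remainders at stage [e] are taken in [j^(p^e) J],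
   which for [e = 0] is [j J]. *)
apply/(fg_idealP idJ); exists r, (\row_t (g t).1); split=> // x /(genN 1%N)[u [c [Jc ->]]].
rewrite expr1.
have [|||y cE] := @lim_nakayama r (fun t => (g t).1)
    (fun e x => exists2 c, J c & x = c * j ^+ (p ^ e)) _ _ (c * j).
- by move=> e _ [b _ ->]; apply: lev_pred; rewrite rmorphM /= lev_pow ?mulr0.
- move=> e _ [b Jb ->].
  have [v [b' [Jb' ->]]] := genN (p ^ e.+1 - p ^ e)%N b Jb.
  exists (fun t => v t 0 * j ^+ (p ^ e)); split=> [t _|].
    by apply: lev_pred; rewrite rmorphM /= lev_pow ?mulr0.
  exists b' => //; rewrite mulrDl -mulrA -exprD subnK; last first.
    by rewrite leq_pexp2l ?prime_gt0.
  rewrite mxE mulr_suml addrAC -sumrB big1 ?add0r // => t _.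
  by rewrite !mxE [_ * (g t).1]mulrC mulrA subrr.
- by exists c.
exists (u + \col_t y t); rewrite mulmxDr [RHS]mxE; congr (_ + _).
by rewrite cE mxE; apply: eq_bigr => t _; rewrite !mxE mulrC.
Qed.

End LimNoetherian.

(** * Relations spanned by syzygies; the Frobenius of a sum *)

Section SyzygySpans.
Variables (C D : comPzRingType) (iota : {rmorphism C -> D}).
Local Notation "M ^i" := (map_mx iota M) (at level 2, format "M ^i").

Lemma syz_span_submodule s r (l : 'M[C]_(s, r)) : is_submodule (syz_span iota l).
Proof.
split=> [|_ _ [q [E [y [-> lE]]]] [q' [E' [y' [-> lE']]]]|a _ [q [E [y [-> lE]]]]].
- by exists 0%N, 0, 0; rewrite !mulmx0.
- exists (q + q')%N, (row_mx E E'), (col_mx y y').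
  by rewrite map_row_mx mul_row_col mul_mx_row lE lE' row_mx0.
- by exists q, E, (a *: y); rewrite -scalemxAr.
Qed.

Lemma syz_span_syz s r (l : 'M[C]_(s, r)) (E : 'cV_r) (y : D) :
  l *m E = 0 -> syz_span iota l (y *: E^i).
Proof. by move=> lE; exists 1%N, E, y%:M; rewrite mul_mx_scalar. Qed.

Lemma syz_fin s (J : finType) (m : J -> 'cV[C]_s) (L : 'cV[C]_s -> Prop) (d : J -> D) :
    syz_good iota L -> (forall v, L v <-> exists u : J -> C, v = \sum_j u j *: m j) ->
    (forall i, \sum_j iota (m j i 0) * d j = 0) ->
  exists q (b : J -> 'I_q -> C) (y : 'I_q -> D),
    (forall j, d j = \sum_t iota (b j t) * y t) /\ forall t, \sum_j b j t *: m j = 0.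
Proof.
move=> [r [l [gl Vl]]] gm md.
pose M : 'M_(s, #|J|) := \matrix_(i, j) m (enum_val j) i 0.
have ME (u : 'cV_#|J|) : M *m u = \sum_j u (enum_rank j) 0 *: m j.
  apply/matrixP=> i k; rewrite ord1 mxE summxE (reindex (@enum_rank J)) /=; last first.
    exact/onW_bij/enum_rank_bij.
  by apply: eq_bigr => j _; rewrite !mxE enum_rankK mulrC.
have gM : generates M L.
  move=> v; rewrite gm; split=> [] [u ->]; last first.
    by exists (fun j => u (enum_rank j) 0); rewrite ME.
  exists (\col_j u (enum_val j)); rewrite ME.
  by apply: eq_bigr => j _; rewrite mxE enum_rankK.
have [|q [E [y [dE lE]]]] := syz_generated_eq gl gM Vl (d := \col_j d (enum_val j)).
  apply/matrixP=> i k; rewrite [RHS]mxE -[RHS](md i) mxE.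
  rewrite (reindex (@enum_rank J)) /=; last exact/onW_bij/enum_rank_bij.
  by apply: eq_bigr => j _; rewrite !mxE enum_rankK.
exists q, (fun j t => E (enum_rank j) t), (fun t => y t 0); split=> [j|t].
  have /matrixP/(_ (enum_rank j) 0) := dE; rewrite !mxE enum_rankK => ->.
  by apply: eq_bigr => t _; rewrite mxE.
have := congr1 (col t) lE; rewrite colE -mulmxA -colE ME col0 => E0.
by rewrite -[RHS]E0; apply: eq_bigr => j _; rewrite mxE.
Qed.

Lemma syz_good_unit (J : C -> Prop) : is_ideal J -> J 1 ->
  syz_good iota (fun v : 'cV_1 => J (v 0 0)).
Proof.
move=> [_ _ JM] J1; exists 1%N, 1%:M; split=> [v|d].
  split=> [_|_]; first by exists v; rewrite mul1mx.
  by rewrite -[v 0 0]mulr1; apply: JM.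
rewrite map_mx1 mul1mx => ->.
by exists 0%N, 0, 0; rewrite !mulmx0.
Qed.

(** This is the Tor sequence of [0 -> C/(J : a) -> C/J -> C/(J + (a)) -> 0], whose first map is
    multiplication by [a]. *)
Lemma syz_good_mul (J : C -> Prop) a : noetherian C -> is_ideal J ->
    syz_good iota (fun v : 'cV_1 => exists x y, J x /\ v 0 0 = x + y * a) ->
    syz_good iota (fun v : 'cV_1 => J (a * v 0 0)) ->
  syz_good iota (fun v : 'cV_1 => J (v 0 0)).
Proof.
move=> /noetherianP noethC idJ [r1 [l1 [gl1 Vl1]]] [r2 [b [gb Vb]]].
case: (idJ) => J0 JD JM.
have [r [c gc]] := noethC J idJ.
have mx11 (v : 'cV[C]_1) (u : 'cV[C]_1) : v = u <-> v 0 0 = u 0 0.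
  by split=> [->//|E]; apply/matrixP=> i j; rewrite !ord1.
have gca : generates (row_mx c a%:M) (fun v : 'cV_1 => exists x y, J x /\ v 0 0 = x + y * a).
  move=> v; split=> [[x [y [/gc[u xE] vE]]]|[u ->]].
    exists (col_mx u y%:M); apply/mx11; rewrite mul_row_col [RHS]mxE -xE vE.
    by rewrite -scalar_mxM [X in _ = _ + X]mxE eqxx mulr1n mulrC.
  exists ((c *m usubmx u) 0 0), (dsubmx u 0 0); split; first by apply/gc; exists (usubmx u).
  rewrite -{1}[u]vsubmxK mul_row_col mul_scalar_mx [LHS]mxE; congr (_ + _).
  by rewrite [LHS]mxE mulrC.
have Vca := syz_generated_eq gl1 gca Vl1.
have Jab j : J (a * b 0 j) by have := generates_col j gb; rewrite mxE.
exists (r + r2)%N, (row_mx c (a *: b)); split.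
  move=> v; split=> [/gc[u vE]|[u ->]].
    by exists (col_mx u 0); apply/mx11; rewrite mul_row_col mulmx0 addr0.
  rewrite -[u]vsubmxK mul_row_col [X in J X]mxE; apply: JD; first by apply/gc; exists (usubmx u).
  by apply: ideal_mulmx => // j; rewrite mxE.
move=> d; rewrite -[d]vsubmxK map_row_mx mul_row_col map_mxZ -scalemxAl => dE.
(* A relation [(d1, d2)] for [(c, a b)] gives the relation [(d1, b d2)] for [(c, a)]. Splitting off
   its syzygies leaves a relation for [b]. *)
have [|q [E [y [+ lE]]]] := Vca (col_mx (usubmx d) (b^i *m dsubmx d)).
  by rewrite map_row_mx mul_row_col map_scalar_mx mul_scalar_mx.
rewrite -[E]vsubmxK map_col_mx mul_col_mx => /eq_col_mx[d1E d2E].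
move: lE; rewrite -[E]vsubmxK mul_row_col mul_scalar_mx => lE.
have [|F FE] := generates_factor (M := dsubmx E) gb.
  move=> j; have /matrixP/(_ 0 j) := lE; rewrite !mxE => /eqP.
  rewrite addrC addr_eq0 => /eqP ->.
  rewrite -mulN1r; apply: JM; have := ideal_mulmx (col j (usubmx E)) idJ (fun j => fg_ideal_gen j gc).
  by rewrite !mxE; congr J; apply: eq_bigr => k _; rewrite !mxE.
have [|q' [E' [y' [dE' bE']]]] := Vb (dsubmx d - F^i *m y).
  by rewrite mulmxBr d2E FE map_mxM mulmxA subrr.
exists (q + q')%N, (block_mx (usubmx E) 0 F E'), (col_mx y y'); split.
  rewrite map_block_mx raddf0 mul_block_col mul0mx addr0 -d1E -dE'.
  by rewrite subrKC.
rewrite mul_row_block mulmx0 add0r -!scalemxAl bE' scaler0 -FE lE.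
by rewrite row_mx0.
Qed.

End SyzygySpans.

(** This yields the additivity of a [p]-th power map modulo [P]. In it [W n] is the polynomial
    [((a + b)^(n+1) - a^(n+1)) / b]. Modulo [P], where [b u = a v], the element
    [(a + b)^n (u + v) - a^n u] is [W n v]; and [W (p - 1) = b^(p-1)] in characteristic [p]. *)
Lemma Frobenius_sum_congr (D : comPzRingType) (V : lmodType D) (P : V -> Prop)
    (p : nat) (a b : D) (u v : V) :
    is_Fp_algebra p D -> P 0 -> (forall x y, P x -> P y -> P (x + y)) ->
    (forall c x, P x -> P (c *: x)) -> P (b *: u - a *: v) ->
  P ((a + b) ^+ p.-1 *: (u + v) - a ^+ p.-1 *: u - b ^+ p.-1 *: v).
Proof.
move=> /andP[pp /eqP pD0] P0 PD PZ Pab.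
pose W n := \sum_(i < n.+1) (a ^+ (n - i) * b ^+ i) *+ 'C(n.+1, i.+1).
have WS n : W n.+1 = a ^+ n.+1 + (a + b) * W n.
  rewrite /W; under eq_bigr => i _ do rewrite binS mulrnDr.
  rewrite big_split big_ord_recr /= bin_small // mulr0n addr0.
  rewrite [X in _ + X]big_ord_recl bin0 mulr1n mulr1 subn0 addrCA; congr (_ + _).
  rewrite mulrDl !mulr_sumr; congr (_ + _); apply: eq_bigr => i _.
    by rewrite mulrnAr mulrA -exprS -subSn // -ltnS.
  by rewrite mulrnAr mulrCA -exprS lift0 subSS.
have PW n : P ((a + b) ^+ n *: (u + v) - a ^+ n *: u - W n *: v).
  elim: n => [|n IHn].
    rewrite /W big_ord1 !expr0 mulr1 binn mulr1n !scale1r.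
    by rewrite -addrA -opprD subrr.
  have := PD _ _ (PZ (a + b) _ IHn) (PZ (a ^+ n) _ Pab).
  congr P; rewrite WS !scalerBr !scalerA -exprS -exprSr !scalerDl mulrDl scalerDl.
  rewrite -exprS [b * _]mulrC -!addrA; congr (_ + _).
  rewrite !opprD -!addrA; congr (_ + _).
  by rewrite addrCA addKr addrC.
have -> // : b ^+ p.-1 = W p.-1.
have p_gt0 := prime_gt0 pp.
rewrite /W big_ord_recr /= prednK // binn mulr1n subnn mul1r big1 ?add0r // => i _.
have /dvdnP[q ->] : (p %| 'C(p, i.+1))%N by rewrite prime_dvd_bin //= -ltn_predRL.
by rewrite mulrnA -mulr_natl pD0 mul0r.
Qed.

(** * Flatness *)

Section FrobeniusSyz.
Variables (p : nat) (C D : comPzRingType) (iota : {rmorphism C -> D}).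
Variables (chD : is_Fp_algebra p D) (r : nat) (c : 'rV[C]_r).
Local Notation "M ^i" := (map_mx iota M) (at level 2, format "M ^i").
Local Notation syz := (@syz_span C D iota 1 r c).
Local Notation ev u := ((c^i *m u) 0 0).

(** The difference is a combination of the Koszul syzygies [c_j e_i - c_i e_j]. In [J (x) D], with
    [J] generated by [c], both terms represent the product of [u] and [v]. *)
Lemma syz_span_koszul (u v : 'cV[D]_r) : syz (ev v *: u - ev u *: v).
Proof.
have [S0 SD SZ] := syz_span_submodule iota c.
have decomp (w : 'cV[D]_r) : w = \sum_i w i 0 *: delta_mx i 0.
  by rewrite {1}[w]matrix_sum_delta; apply: eq_bigr => i _; rewrite big_ord1.
have -> : ev v *: u - ev u *: v =
    \sum_i \sum_j (u i 0 * v j 0) *: (c 0 j *: delta_mx i 0 - c 0 i *: delta_mx j 0 : 'cV_r)^i.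
  rewrite {1}(decomp u) {2}(decomp v) ![(_ *m _) _ _]mxE !scaler_suml.
  under [X in X - _]eq_bigr => j _ do rewrite scaler_sumr.
  rewrite exchange_big -sumrB; apply: eq_bigr => i _ /=.
  rewrite scaler_sumr -sumrB; apply: eq_bigr => j _.
  rewrite map_mxB !map_mxZ !map_delta_mx !mxE scalerBr !scalerA.
  congr (_ *: _ - _ *: _); first by rewrite -mulrA mulrC [v j 0 * _]mulrC.
  by rewrite -mulrA mulrC.
elim/big_ind: _ => // i _; elim/big_ind: _ => // j _.
apply: syz_span_syz; rewrite mulmxBr -!scalemxAr -!colE; apply/matrixP=> k l.
by rewrite !mxE !ord1 mulrC subrr.
Qed.

(* The Frobenius of J (x) D, for J the ideal generated by c, kills the kernel
   of J (x) D -> D: this nonunital ring has product (j (x) d)(j' (x) d') =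
   jj' (x) dd', so that the kernel has square zero. *)
Lemma syz_span_Frobenius (d : 'cV[D]_r) :
  c^i *m d = 0 -> syz (\col_i (iota (c 0 i) ^+ p.-1 * d i 0 ^+ p)).
Proof.
move=> cd; have /andP[pp _] := chD.
have [S0 SD SZ] := syz_span_submodule iota c.
(* The [p]-th power of [u] in [J (x) D], where multiplication by [u] is scaling by [ev u]. *)
pose g u : 'cV[D]_r := ev u ^+ p.-1 *: u.
have evD u v : ev (u + v) = ev u + ev v by rewrite mulmxDr mxE.
have gD u v : syz (g (u + v) - g u - g v).
  rewrite /g evD; apply: Frobenius_sum_congr chD _ _ _ _ => //.
  exact: syz_span_koszul.
have pp0 : (0 < p.-1)%N by rewrite -ltnS prednK ?prime_gt1 ?prime_gt0.
have g0 u : ev u = 0 -> g u = 0 by move=> u0; rewrite /g u0 expr0n -[_ == _]negbK -lt0n pp0 scale0r.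
pose e i : 'cV[D]_r := d i 0 *: delta_mx i 0.
have dE : d = \sum_i e i.
  apply/matrixP=> i j; rewrite ord1 summxE (bigD1 i) //= big1 => [|k ki].
    by rewrite !mxE !eqxx mulr1 addr0.
  by rewrite !mxE eq_sym (negPf ki) mulr0.
have gE : \col_i (iota (c 0 i) ^+ p.-1 * d i 0 ^+ p) = \sum_i g (e i).
  apply/matrixP=> i j; rewrite ord1 summxE (bigD1 i) //= big1 => [|k ki].
    rewrite !mxE (bigD1 i) //= big1 => [|k ki]; last first.
      by rewrite !mxE (negPf ki) !mulr0.
    rewrite !mxE !eqxx !mulr1 !addr0 exprMn -mulrA -exprSr prednK ?prime_gt0 //.
  by rewrite [g _ _ _]mxE [e _ _ _]mxE [delta_mx _ _ _ _]mxE eq_sym (negPf ki) !mulr0.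
suff : syz (g d - \sum_i g (e i)).
  rewrite -gE g0 ?cd ?mxE // sub0r => Sd.
  by rewrite -[X in syz X]opprK -scaleN1r; apply: SZ.
rewrite {1}dE; elim/big_rec2: _ => [|i v u _ Suv].
  by rewrite g0 ?subr0 // mulmx0 mxE.
have := SD _ _ (gD (e i) u) Suv; congr syz.
by rewrite addrA subrK opprD addrA.
Qed.

End FrobeniusSyz.

Lemma ideal_exp (A : comPzRingType) (J : A -> Prop) n x :
  is_ideal J -> (0 < n)%N -> J x -> J (x ^+ n).
Proof. by case: n => // n [_ _ JM] _ Jx; rewrite exprSr; apply: JM. Qed.

Section Flatness.
Variables (p : nat) (pp : prime p) (I : finType) (C D : pring p I) (iota : phom C D).
Local Notation K := {ffun I -> 'I_p}.
Hypothesis bijC : bijective (rfrob (B := C) : ext pp C -> C).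
Hypothesis bijD : bijective (rfrob (B := D) : ext pp D -> D).
Hypothesis noethC : noetherian C.
Local Notation "M ^i" := (map_mx iota M) (at level 2, format "M ^i").
Local Notation good J := (@syz_good C D iota 1 (fun v => J (v 0 0))).

Lemma prime_prod (P : C -> Prop) (J : finType) (F : J -> C) :
  ~ P 1 -> (forall a b, P (a * b) -> P a \/ P b) -> (forall j, ~ P (F j)) -> ~ P (\prod_j F j).
Proof.
move=> nP1 Pp nPF; elim/big_ind: _ => // x y nPx nPy /Pp[].
  exact: nPx.
exact: nPy.
Qed.

(** A maximal independent set [S] of monomials spans a free submodule [(C/P)^S] of [F_*(C/P)], and
    the quotient is killed by some [A] outside [P]. By induction that quotient has no Tor, so
    [Tor_1(F_*(C/P), D)] comes from [Tor_1(C/P, D)^S], through a Frobenius that is 0. *)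
Lemma flat_prime_step (P : C -> Prop) :
    is_ideal P -> ~ P 1 -> (forall a b, P (a * b) -> P a \/ P b) ->
    (forall J : C -> Prop, is_ideal J -> (forall x, P x -> J x) -> (exists x, J x /\ ~ P x) ->
       good J) ->
  good P.
Proof.
move=> idP nP1 Pp IH; case: (idP) => P0 PD PM.
have PN x : P x -> P (- x) by rewrite -mulN1r; apply: PM.
have Psum (J : finType) (S : pred J) (F : J -> C) : (forall j, S j -> P (F j)) -> P (\sum_(j | S j) F j).
  by move=> PF; elim/big_ind: _.
have p_gt0 := prime_gt0 pp.
have Pexp x : P x -> P (x ^+ p).
  exact: ideal_exp.
have [coef [coefK coefE]] : exists g : C -> ext pp C, cancel (rfrob (B := C)) g /\
    cancel g (rfrob (B := C)) by case: bijC => g; exists g.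
have [coefD [coefDK coefDE]] : exists g : D -> ext pp D, cancel (rfrob (B := D)) g /\
    cancel g (rfrob (B := D)) by case: bijD => g; exists g.
pose mu (k : K) := mon C (expo_val k).
pose vec (v : 'cV[C]_#|K|) : ext pp C := [ffun k => v (enum_rank k) 0].
pose cvec (x : C) : 'cV[C]_#|K| := \col_i coef x (enum_val i).
have vec_inj v w : rfrob (vec v) = rfrob (vec w) -> v = w.
  move=> /(can_inj coefK)/ffunP E; apply/matrixP=> i j; rewrite ord1.
  by have := E (enum_val i); rewrite !ffunE enum_valK.
have cvecE x : rfrob (vec (cvec x)) = x.
  by rewrite -[RHS]coefE; congr rfrob; apply/ffunP=> k; rewrite !(ffunE, mxE) enum_rankK.
have vecE v : rfrob (vec v) = \sum_k v (enum_rank k) 0 ^+ p * mu k.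
  by apply: eq_bigr => k _; rewrite ffunE.
have vecD v w : rfrob (vec (v + w)) = rfrob (vec v) + rfrob (vec w).
  by rewrite -raddfD; congr rfrob; apply/ffunP=> k; rewrite !(ffunE, mxE).
have vecZ a v : rfrob (vec (a *: v)) = a ^+ p * rfrob (vec v).
  rewrite !vecE mulr_sumr; apply: eq_bigr => k _.
  by rewrite mxE exprMn mulrA.
have vec0 : rfrob (vec 0) = 0 by rewrite -(scale0r 0) vecZ frob0 mul0r.
have vec_sum (J : finType) (F : J -> 'cV_#|K|) :
    rfrob (vec (\sum_j F j)) = \sum_j rfrob (vec (F j)).
  exact: (big_morph (fun v => rfrob (vec v)) vecD vec0).
have vec_delta k : rfrob (vec (delta_mx (enum_rank k) 0)) = mu k.
  rewrite vecE (bigD1 k) //= big1 => [|l lk].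
    by rewrite mxE !eqxx expr1n mul1r addr0.
  by rewrite mxE (inj_eq enum_rank_inj) (negPf lk) frob0 mul0r.
have [r [c gc]] := (noetherianP C).1 noethC P idP.
have Pc i : P (c 0 i) by apply: fg_ideal_gen gc.
(* a maximal set of monomials linearly independent modulo P over (C / P)^p *)
pose indep (S : {set K}) := `[< forall a : K -> C,
  P (\sum_(k in S) a k ^+ p * mu k) -> forall k, k \in S -> P (a k) >].
have [S /maxsetP[/asboolP indS maxS]] : {S | maxset indep S}.
  apply: ex_maxset; exists finset.set0; apply/asboolP => a _ k.
  by rewrite finset.inE.
have /choice[a aP] : forall k, exists ak, ~ P ak /\ (k \notin S ->
    exists b : K -> C, P (ak ^+ p * mu k + \sum_(j in S) b j ^+ p * mu j)).
  move=> k; have [kS|kS] := boolP (k \in S); first by exists 1; split.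
  have [nind|ind] := pselect (indep (k |: S)%SET); last first.
    have [b [Pb nPb]] : exists b : K -> C, P (\sum_(j in (k |: S)%SET) b j ^+ p * mu j) /\
        ~ forall j, j \in (k |: S)%SET -> P (b j).
      apply: contrapT => no; apply: ind; apply/asboolP => b Pb.
      by apply: contrapT => nPb; apply: no; exists b.
    rewrite big_setU1 //= in Pb; exists (b k); split=> [Pbk|_]; last by exists b.
    apply: nPb => j; rewrite !finset.inE => /orP[/eqP->//|]; apply: indS.
    have := PD _ _ (PN _ (PM (mu k) _ (Pexp _ Pbk))) Pb.
    by rewrite [mu k * _]mulrC addKr.
  by have := maxS _ nind (finset.subsetUr _ _) => SE; rewrite -SE finset.setU11 in kS.
pose A := \prod_k a k.
have nPA : ~ P A by apply: prime_prod => // k; case: (aP k).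
(* The preimage in C^K = F_*C of the span of S in F_*(C / P). *)
pose L v := exists b : K -> C, P (rfrob (vec v) + \sum_(j in S) b j ^+ p * mu j).
have subL : is_submodule L.
  have Sexp0 : \sum_(j in S) (0 : C) ^+ p * mu j = 0.
    by apply: big1 => j _; rewrite frob0 mul0r.
  split=> [|v w [b Pb] [b' Pb']|x v [b Pb]].
  - by exists (fun=> 0); rewrite vec0 Sexp0 addr0.
  - exists (fun j => b j + b' j); rewrite vecD.
    under eq_bigr => j _ do rewrite frobD mulrDl.
    by rewrite big_split addrACA; apply: PD.
  - exists (fun j => x * b j); rewrite vecZ.
    under eq_bigr => j _ do rewrite exprMn -mulrA.
    by rewrite -mulr_sumr -mulrDr; apply: PM.
case: (subL) => L0 LD LZ.
have frobN x : (- x) ^+ p = - x ^+ p := raddfN (Frobenius (pr_char C)) x.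
have Sexp0 : \sum_(j in S) (0 : C) ^+ p * mu j = 0.
  by apply: big1 => j _; rewrite frob0 mul0r.
have Ldelta k : k \in S -> L (delta_mx (enum_rank k) 0).
  move=> kS; exists (fun j => - (j == k)%:R); rewrite vec_delta (bigD1 k) //= big1 => [|j /andP[_ jk]].
    by rewrite eqxx addr0 frobN expr1n mulN1r subrr.
  by rewrite (negPf jk) oppr0 frob0 mul0r.
have LJ0 x v : P x \/ x = A -> L (x *: v).
  case=> [Px|->].
    by exists (fun=> 0); rewrite vecZ Sexp0 addr0 mulrC; apply/PM/Pexp.
  rewrite -mul_scalar_mx; apply: is_submodule_mulmx => // j.
  have -> : col j A%:M = A *: delta_mx (enum_rank (enum_val j)) 0 :> 'cV_#|K|.
    by apply/matrixP=> i k; rewrite !mxE enum_valK ord1 andbT mulr_natr.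
  rewrite /A (bigD1 (enum_val j)) //= mulrC -scalerA; apply: (LZ).
  have [kS|kS] := boolP (enum_val j \in S); first by apply: LZ; apply: Ldelta.
  have [_ /(_ kS)[b Pb]] := aP (enum_val j).
  by exists b; rewrite vecZ vec_delta.
have goodL : syz_good iota L.
  apply: (@syz_good_filtration _ _ iota (fun x => P x \/ x = A)) => // J idJ J0J.
  apply: IH => // [x Px|]; first by apply: J0J; left.
  by exists A; split=> //; apply: J0J; right.
(* Generators of [L]: the basis vectors for [k] in [S], and the coordinates of the [c_i mu_k], which
   generate [F_*P] over [C]. *)
pose m (j : K + 'I_r * K) : 'cV[C]_#|K| := match j with
  | inl k => if k \in S then delta_mx (enum_rank k) 0 else 0
  | inr ik => cvec (c 0 ik.1 * mu ik.2) end.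
have ev_m (R : comPzRingType) (h : {rmorphism C -> R}) (u : K + 'I_r * K -> R) :
    \sum_j u j ^+ p * h (rfrob (vec (m j))) =
    \sum_(k in S) u (inl k) ^+ p * h (mu k) +
    \sum_i h (c 0 i) * \sum_k u (inr (i, k)) ^+ p * h (mu k).
  rewrite big_sumType; congr (_ + _).
    rewrite [RHS]big_mkcond; apply: eq_bigr => k _ /=.
    by case: ifP; rewrite ?vec_delta // vec0 rmorph0 mulr0.
  under [RHS]eq_bigr => i _ do rewrite mulr_sumr.
  rewrite pair_big; apply: eq_bigr => -[i k] _ /=.
  by rewrite cvecE rmorphM mulrCA.
have ev_msum (u : K + 'I_r * K -> C) : rfrob (vec (\sum_j u j *: m j)) =
    \sum_(k in S) u (inl k) ^+ p * mu k +
    \sum_i c 0 i * \sum_k u (inr (i, k)) ^+ p * mu k.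
  rewrite -(ev_m _ idfun) vec_sum; apply: eq_bigr => j _.
  by rewrite vecZ.
have gm v : L v <-> exists u, v = \sum_j u j *: m j.
  split=> [[b /gc[x xE]]|[u ->]]; last first.
    elim/big_ind: _ => // j _; apply: LZ; case: j => [k|[i k]] /=.
      by case: ifP => // /Ldelta.
    by exists (fun=> 0); rewrite Sexp0 addr0 cvecE mulrC; apply: PM.
  exists (fun j => match j with inl k => - b k | inr ik => coef (x ik.1 0) ik.2 end).
  apply: vec_inj; rewrite ev_msum /=.
  under [X in X + _]eq_bigr => k _ do rewrite frobN mulNr.
  rewrite sumrN -[LHS](addrK (\sum_(j in S) b j ^+ p * mu j)) xE addrC mxE.
  by congr (_ + _); apply: eq_bigr => i _; rewrite -[in LHS](coefE (x i 0)).
exists r, c; split; first exact/generates_ideal.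
move=> d cd; pose muD (k : K) := mon D (expo_val k).
(* Expanding [d_i = sum d_ik^p mu_k] and comparing coordinates turns the relation on the [c_i] into
   a relation on the generators of [L], with coefficients 0 on [S]. *)
pose dd (j : K + 'I_r * K) : D := match j with
  | inl _ => 0 | inr ik => coefD (d ik.1 0) ik.2 end.
have iota_mu k : iota (mu k) = muD k by apply: phom_mon.
have [|q [b [y [ddE bm]]]] := syz_fin (d := dd) goodL gm.
  move=> i0; pose u : ext pp D := [ffun k => \sum_j iota (m j (enum_rank k) 0) * dd j].
  suff /ffunP/(_ (enum_val i0)) : u = 0 by rewrite !ffunE enum_valK.
  apply: (can_inj coefDK); rewrite raddf0.
  transitivity (\sum_j dd j ^+ p * iota (rfrob (vec (m j)))).
    under [RHS]eq_bigr => j _ do rewrite vecE rmorph_sum mulr_sumr.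
    rewrite exchange_big; apply: eq_bigr => k _ /=.
    rewrite ffunE frob_sum mulr_suml; apply: eq_bigr => j _.
    by rewrite rmorphM rmorphXn iota_mu exprMn mulrCA mulrA.
  rewrite ev_m big1 ?add0r => [|k _]; last by rewrite frob0 mul0r.
  have /matrixP/(_ 0 0) := cd; rewrite !mxE => cd0; rewrite -[RHS]cd0; apply: eq_bigr => i _.
  rewrite !mxE; congr (_ * _); rewrite -[RHS]coefDE; apply: eq_bigr => k _.
  by rewrite iota_mu.
pose eps t i := \sum_k b (inr (i, k)) t ^+ p * mu k.
have relE t : \sum_(k in S) b (inl k) t ^+ p * mu k + \sum_i c 0 i * eps t i = 0.
  by rewrite -(ev_msum (b^~ t)) bm vec0.
(* The monomials in [S] are independent modulo [P], so the coefficients on [S] of every syzygy lie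
   in [P] and can be expressed by [c]. *)
have Pb k t : k \in S -> P (b (inl k) t).
  move: k; apply: indS; have /eqP := relE t; rewrite addr_eq0 => /eqP ->.
  by apply: PN; apply: Psum => i _; rewrite mulrC; apply: PM.
have /choice[w wE] : forall kt : K * 'I_q, exists w : 'cV_r,
    kt.1 \in S -> b (inl kt.1) kt.2 = (c *m w) 0 0.
  move=> [k t]; have [/(Pb k t)/gc[w wE]|_] := boolP (k \in S); first by exists w.
  by exists 0.
pose g k : 'cV[D]_r := \col_i \sum_t iota (w (k, t) i 0) * y t.
have cg k : k \in S -> c^i *m g k = 0.
  move=> kS; apply/matrixP=> i j; rewrite !ord1 [RHS]mxE.
  have /= d0 := ddE (inl k); rewrite [RHS]d0 mxE /g.
  under [LHS]eq_bigr => l _ do rewrite !mxE mulr_sumr.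
  rewrite exchange_big; apply: eq_bigr => t _ /=.
  rewrite (wE (k, t) kS) mxE rmorph_sum mulr_suml; apply: eq_bigr => l _.
  by rewrite rmorphM mulrA.
(* From [b_k = sum c_i w_ki] one gets [b_k^p = sum c_i (c_i^(p-1) w_ki^p)], so that the part on [S]
   is absorbed into a syzygy of [c]. *)
pose E t : 'cV[C]_r := \col_i (eps t i +
  \sum_(k in S) w (k, t) i 0 ^+ p * c 0 i ^+ p.-1 * mu k).
have cE t : c *m E t = 0.
  apply/matrixP=> i j; rewrite !ord1 [RHS]mxE -[RHS](relE t) mxE addrC /E.
  under eq_bigr => l _ do rewrite mxE mulrDr mulr_sumr.
  rewrite big_split; congr (_ + _); rewrite exchange_big; apply: eq_bigr => k kS /=.
  rewrite (wE (k, t) kS) mxE frob_sum mulr_suml; apply: eq_bigr => l _.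
  rewrite exprMn !mulrA; congr (_ * _); rewrite mulrAC -exprS prednK // mulrC.
have [S0 SD SZ] := syz_span_submodule iota c.
have SN (v : 'cV[D]_r) : syz_span iota c v -> syz_span iota c (- v).
  by rewrite -scaleN1r; apply: SZ.
(* The correction consists of Frobenius images of the [g k], which are relations for [c] because
   [dd] is 0 on [S]. *)
have -> : d = \sum_t y t ^+ p *: (E t)^i -
    \sum_(k in S) muD k *: \col_i (iota (c 0 i) ^+ p.-1 * g k i 0 ^+ p).
  apply/matrixP=> i j; rewrite ord1 !mxE !summxE.
  have -> : d i 0 = \sum_t y t ^+ p * iota (eps t i).
    rewrite -[LHS]coefDE.
    under [RHS]eq_bigr => t _ do rewrite rmorph_sum mulr_sumr.
    rewrite exchange_big; apply: eq_bigr => k _ /=.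
    have := ddE (inr (i, k)); rewrite /= => ->; rewrite frob_sum mulr_suml.
    apply: eq_bigr => t _; rewrite rmorphM rmorphXn /= iota_mu exprMn.
    by rewrite mulrCA mulrA.
  under [X in _ = X - _]eq_bigr => t _ do rewrite !mxE rmorphD mulrDr.
  rewrite big_split -addrA [X in _ = _ + X](_ : _ = 0) ?addr0 //; apply/eqP.
  rewrite subr_eq0; apply/eqP.
  under eq_bigr => t _ do rewrite rmorph_sum mulr_sumr.
  rewrite exchange_big; apply: eq_bigr => k kS /=.
  rewrite !mxE frob_sum !mulr_sumr; apply: eq_bigr => t _.
  rewrite !rmorphM !rmorphXn /= iota_mu exprMn.
  rewrite mulrA [RHS]mulrC; congr (_ * _).
  by rewrite [RHS]mulrA [RHS]mulrC [_ * iota (w _ _ _) ^+ p]mulrC.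
apply: (SD).
  by apply: (big_ind (syz_span iota c)) => // t _; apply: syz_span_syz.
apply: SN; apply: (big_ind (syz_span iota c)) => // k kS; apply: (SZ).
by apply: syz_span_Frobenius; [apply: pr_char|apply: cg].
Qed.

Theorem pbasis_flat r (l : 'rV[C]_r) : syz_generated iota l.
Proof.
have [|||r' [l' [gl' Vl']]] := @ideal_ind C (fun J => good J) _ _
    (fun x => exists u : 'cV_r, x = (l *m u) 0 0).
- by move=> J _ [r' [l' [/generates_ideal gl' _]]]; exists r', l'.
- move=> J idJ IH; have [J1|nJ1] := pselect (J 1); first exact: syz_good_unit.
  have [Pp|nP] := pselect (forall a b, J (a * b) -> J a \/ J b).
    exact: flat_prime_step.
  have [a [b [Jab nJa nJb]]] : exists a b, [/\ J (a * b), ~ J a & ~ J b].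
    apply: contrapT => no; apply: nP => a b Jab.
    have [Ja|nJa] := pselect (J a); [by left|right].
    by apply: contrapT => nJb; apply: no; exists a, b.
  (* Both [J + (a)] and [(J : a)] are strictly larger than [J]: the first contains [a], the second
     [b]. *)
  case: (idJ) => J0 JD JM; apply: (@syz_good_mul _ _ iota J a) => //.
    apply: (IH (fun z => exists x y, J x /\ z = x + y * a)).
    - split=> [|_ _ [x [y [Jx ->]]] [x' [y' [Jx' ->]]]|z _ [x [y [Jx ->]]]].
      + by exists 0, 0; rewrite mul0r addr0.
      + by exists (x + x'), (y + y'); rewrite mulrDl addrACA; split=> //; apply: JD.
      + by exists (z * x), (z * y); rewrite mulrDr mulrA; split=> //; apply: JM.
    - by move=> x Jx; exists x, 0; rewrite mul0r addr0.
    - by exists a; split=> //; exists 0, 1; rewrite mul1r add0r.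
  apply: (IH (fun z => J (a * z))) => [|x Jx|].
  - split=> [|x y Jx Jy|z x Jx]; first by rewrite mulr0.
      by rewrite mulrDr; apply: JD.
    by rewrite mulrCA; apply: JM.
  - exact: JM.
  - by exists b.
- split=> [|_ _ [u ->] [v ->]|a _ [u ->]].
  + by exists 0; rewrite mulmx0 mxE.
  + by exists (u + v); rewrite mulmxDr [RHS]mxE.
  + by exists (a *: u); rewrite -scalemxAr [RHS]mxE.
apply: syz_generated_eq gl' _ Vl'.
by apply/(generates_ideal l (fun x => exists u : 'cV_r, x = (l *m u) 0 0)).
Qed.

End Flatness.

(** * The factorization *)

Section QuotientRing.
Local Open Scope quotient_scope.
Variables (D : comPzRingType) (J : D -> Prop) (idJ : is_ideal J).

(** [J] may be the whole ring: the quotient is formed additively and multiplied on representatives,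
    which allows the zero ring. *)
Definition quo_pred : {pred D} := fun x => `[< J x >].
Fact quo_pred_closed : zmod_closed quo_pred.
Proof.
case: idJ => J0 JD JM; split=> [|x y /asboolP Jx /asboolP Jy]; apply/asboolP => //.
by apply: JD => //; rewrite -mulN1r; apply: JM.
Qed.
HB.instance Definition _ := GRing.isZmodClosed.Build D quo_pred quo_pred_closed.

Definition quo : Type := Quotient.quot quo_pred.
HB.instance Definition _ := GRing.Zmodule.on quo.

Definition quo_pi (x : D) : quo := \pi_(Quotient.quot quo_pred) x.
Definition quo_mul (x y : quo) : quo :=
  quo_pi (repr (x : Quotient.quot quo_pred) * repr (y : Quotient.quot quo_pred)).

Lemma quo_pi_eq x y : (quo_pi x = quo_pi y) <-> J (x - y).
Proof.
split=> [/eqP|Jxy]; last by apply/eqP; rewrite /quo_pi -Quotient.idealrBE; apply/asboolP.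
by rewrite /quo_pi -Quotient.idealrBE => /asboolP.
Qed.

Lemma quo_piK (x : quo) : quo_pi (repr (x : Quotient.quot quo_pred)) = x.
Proof. exact: reprK. Qed.

Lemma quo_mulE x y : quo_mul (quo_pi x) (quo_pi y) = quo_pi (x * y).
Proof.
have [_ JD JM] := idJ; apply/quo_pi_eq; rewrite /quo_pi.
set x' := repr _; set y' := repr _.
have -> : x' * y' - x * y = x' * (y' - y) + y * (x' - x).
  by rewrite mulrBr mulrBr addrA [y * x']mulrC subrK [y * x]mulrC.
by apply: JD; apply: JM; apply/quo_pi_eq; apply: quo_piK.
Qed.

Fact quo_pi_nmod_morphism : nmod_morphism quo_pi.
Proof. by split=> [|x y]; rewrite /quo_pi ?raddf0 ?raddfD. Qed.
HB.instance Definition _ := GRing.isNmodMorphism.Build D quo quo_pi quo_pi_nmod_morphism.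

Fact quo_mulA : associative quo_mul.
Proof.
by move=> x y z; rewrite -[x]quo_piK -[y]quo_piK -[z]quo_piK !quo_mulE mulrA.
Qed.
Fact quo_mulC : commutative quo_mul.
Proof. by move=> x y; rewrite -[x]quo_piK -[y]quo_piK !quo_mulE mulrC. Qed.
Fact quo_mul1 : left_id (quo_pi 1) quo_mul.
Proof. by move=> x; rewrite -[x]quo_piK !quo_mulE mul1r. Qed.
Fact quo_mulDl : left_distributive quo_mul +%R.
Proof.
move=> x y z; rewrite -[x]quo_piK -[y]quo_piK -[z]quo_piK.
by rewrite -raddfD !quo_mulE mulrDl raddfD.
Qed.
HB.instance Definition _ := GRing.Zmodule_isComPzRing.Build quo
  quo_mulA quo_mulC quo_mul1 quo_mulDl.

Fact quo_pi_monoid_morphism : monoid_morphism quo_pi.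
Proof. by split=> // x y; rewrite -quo_mulE. Qed.
HB.instance Definition _ :=
  GRing.isMonoidMorphism.Build D quo quo_pi quo_pi_monoid_morphism.

End QuotientRing.

Lemma quotient_ring_exists (D : comPzRingType) (J : D -> Prop) : is_ideal J ->
  exists (T : comPzRingType) (q : {rmorphism D -> T}),
    surjective q /\ forall x, q x = 0 <-> J x.
Proof.
move=> idJ; exists (quo idJ : comPzRingType), (quo_pi idJ : {rmorphism _ -> _}).
split=> [y|x]; first by exists (repr (y : Quotient.quot (quo_pred J))); apply: quo_piK.
by rewrite -[0](raddf0 (quo_pi idJ)) /= quo_pi_eq subr0.
Qed.

Lemma rmorphism_factor (D T B : comPzRingType) (q : {rmorphism D -> T})
    (f : {rmorphism D -> B}) :
    surjective q -> (forall x, q x = 0 -> f x = 0) ->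
  exists h : {rmorphism T -> B}, forall x, h (q x) = f x.
Proof.
move=> /choice[s sK] qf.
have qfE x y : q x = q y -> f x = f y.
  move=> /eqP; rewrite -subr_eq0 -rmorphB => /eqP/qf; rewrite rmorphB => /eqP.
  by rewrite subr_eq0 => /eqP.
pose h t := f (s t).
have hN : nmod_morphism h.
  split=> [|x y]; rewrite /h; first by rewrite (qfE _ 0) ?rmorph0 // sK rmorph0.
  by rewrite -rmorphD; apply: qfE; rewrite rmorphD !sK.
have hM : monoid_morphism h.
  split=> [|x y]; rewrite /h; first by rewrite (qfE _ 1) ?rmorph1 // sK rmorph1.
  by rewrite -rmorphM; apply: qfE; rewrite rmorphM !sK.
pose hA := GRing.isNmodMorphism.Build T B h hN.
pose hB := GRing.isMonoidMorphism.Build T B h hM.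
pose H : {rmorphism T -> B} := HB.pack h hA hB.
by exists H => x; apply: qfE; apply: sK.
Qed.

Lemma noetherian_surj (D T : comPzRingType) (q : {rmorphism D -> T}) :
  surjective q -> noetherian D -> noetherian T.
Proof.
move=> surjq /noetherianP noethD; apply/noetherianP => J [J0 JD JM].
have [|r [l lP]] := noethD (fun x => J (q x)).
  split=> [|x y|a x]; first by rewrite rmorph0.
    by rewrite rmorphD; apply: JD.
  by rewrite rmorphM; apply: JM.
exists r, (map_mx q l) => x; split=> [|[u ->]].
  have [y <-] := surjq x => /lP[u ->]; exists (map_mx q u).
  by rewrite -map_mxM [RHS]mxE.
have /choice[v vE] := fun i => surjq (u i 0).
have -> : u = map_mx q (\col_i v i) by apply/matrixP=> i j; rewrite !mxE ord1 vE.
by rewrite -map_mxM mxE; apply/lP; exists (\col_i v i).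
Qed.

(** * Base change from the limits to the original ring *)

Definition lim_base p (pp : prime p) (I : finType) (B : pring p I) :
    {rmorphism lim pp B -> B} :=
  (@lev p pp I B 0 : {rmorphism lim pp B -> tow pp B 0}).

Section Factorization.
Variables (p : nat) (pp : prime p) (I : finType) (A B : pring p I) (f : phom A B).
Hypothesis surjA : surjective (rfrob (B := A) : ext pp A -> A).
Hypothesis surjB : surjective (rfrob (B := B) : ext pp B -> B).
Local Notation K := {ffun I -> 'I_p}.
Local Notation C := (lim pp A).
Local Notation D := (lim pp B).
Let iota : {rmorphism C -> D} := limM pp f.
Local Notation "M ^i" := (map_mx iota M) (at level 2, format "M ^i").

Let J (x : D) : Prop := exists r (w : 'rV[C]_r) (u : 'cV[D]_r),
  (forall j, lev 0 (w 0 j) = 0) /\ x = (w^i *m u) 0 0.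

Fact kernel_ext_ideal : is_ideal J.
Proof.
split=> [|_ _ [r [w [u [w0 ->]]]] [r' [w' [u' [w'0 ->]]]]|a _ [r [w [u [w0 ->]]]]].
- by exists 0%N, 0, 0; rewrite mulmx0 mxE; split=> // -[].
- exists (r + r')%N, (row_mx w w'), (col_mx u u'); split=> [j|].
    by rewrite mxE; case: (split j) => k; [apply: w0|apply: w'0].
  by rewrite map_row_mx mul_row_col [RHS]mxE.
- by exists r, w, (a *: u); rewrite -scalemxAr [RHS]mxE.
Qed.

Variables (T : comPzRingType) (q : {rmorphism D -> T}).
Variables (g : {rmorphism A -> T}).
Hypothesis (surjq : surjective q) (kerq : forall x, q x = 0 <-> J x).
Hypothesis gE : forall u : C, g (lev 0 u) = q (iota u).

Lemma quotient_flat r (l : 'rV[A]_r) : noetherian A -> syz_generated g l.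
Proof.
move=> noethA d ld.
have noethC : noetherian C by apply: lim_noetherian.
have /choice[sA sAE] := lev0_surj surjA; have /choice[sT sTE] := surjq.
pose w1 := map_mx sA l; pose d1 := map_mx sT d.
have [|r2 [w2 [u [w20 E2]]]] := (kerq ((w1^i *m d1) 0 0)).1.
  have /matrixP/(_ 0 0) := ld; rewrite [RHS]mxE => ld0; rewrite -[RHS]ld0 !mxE rmorph_sum.
  by apply: eq_bigr => i _; rewrite !mxE rmorphM /= -gE sAE sTE.
(* The lifted relation holds only modulo [J]; extending the row by [w2], with entries in the kernel
   of [C -> A], makes it exact. Under [lev 0] these entries vanish, so the upper halves of the
   syzygies become syzygies of [l]. *)
have [|s [E [y [dE lE]]]] := @pbasis_flat p pp I (limP pp A) (limP pp B) (limM pp f)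
    (rfrob_lim_bij pp A) (rfrob_lim_bij pp B) noethC _ (row_mx w1 w2) (col_mx d1 (- u)).
  rewrite map_row_mx mul_row_col mulmxN; apply/matrixP=> i j; rewrite !ord1 !mxE.
  by apply/eqP; rewrite subr_eq0; move: E2; rewrite !mxE => ->.
exists s, (map_mx (lev 0) (usubmx E)), (map_mx q y); split.
  have -> : d = map_mx q d1 by apply/matrixP=> i j; rewrite !mxE sTE.
  move: dE; rewrite -{1}[E]vsubmxK map_col_mx mul_col_mx => /eq_col_mx[-> _].
  rewrite map_mxM -!map_mx_comp; congr (_ *m _).
  by apply/matrixP=> i j; rewrite !mxE /= gE.
pose lev0 := lim_base pp A.
have -> : l = map_mx lev0 w1 by apply/matrixP=> i j; rewrite !mxE; apply/esym/sAE.
rewrite -[map_mx (lev 0) _]/(map_mx lev0 _) -map_mxM; move: lE; rewrite -{1}[E]vsubmxK mul_row_col => /eqP.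
rewrite addr_eq0 => /eqP ->; rewrite map_mxN map_mxM.
have -> : map_mx lev0 w2 = 0 by apply/matrixP=> i j; rewrite !mxE ord1; apply: w20.
by rewrite mul0mx oppr0.
Qed.

Lemma quotient_relatively_perfect (chA : is_Fp_algebra p A) :
  bijective (rel_Frobenius (f := g) (chA := chA)).
Proof.
pose TA := algtensor g (Frobenius chA).
have pureZ (a : A) (t : T) (b : A) :
    alg_pure g (Frobenius chA) (g a * t) b = alg_pure g (Frobenius chA) t (a ^+ p * b).
  rewrite /alg_pure -[X in _ = pure_tensor _ X]/(a *: (b : restr (Frobenius chA))).
  by rewrite pure_tensorZr -pure_tensorZl.
have pure0 t : alg_pure g (Frobenius chA) t 0 = 0.
  by apply: (addrI (alg_pure g (Frobenius chA) t 0)); rewrite addr0 /alg_pure -pure_tensorDr addr0.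
have pure_sum (J' : finType) (t : T) (F : J' -> A) : alg_pure g (Frobenius chA) t (\sum_j F j) =
    \sum_j alg_pure g (Frobenius chA) t (F j).
  by apply: (big_morph (alg_pure g (Frobenius chA) t) _ (pure0 t)) => a b; apply: pure_tensorDr.
(* The inverse map, read off from [x = sum x_k^p z^k]. It kills [J]: a factor [iota w] of a term
   moves into the second tensor factor as [lev 0 w], which is 0. *)
pose phi (x : D) : TA := \sum_k alg_pure g (Frobenius chA) (q (lim_coef x k)) (mon A (expo_val k)).
have phiD x y : phi (x + y) = phi x + phi y.
  rewrite /phi -big_split; apply: eq_bigr => k _ /=.
  have -> : lim_coef (x + y) k = lim_coef x k + lim_coef y k.
    by apply: lim_eq => e; rewrite /= ffunE.
  by rewrite rmorphD /alg_pure pure_tensorDl.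
have phi0 : phi 0 = 0 by apply: (addrI (phi 0)); rewrite -phiD !addr0.
have phiE (x : D) (u : C) : phi (x ^+ p * iota u) = alg_pure g (Frobenius chA) (q x) (lev 0 u).
  have coefE k : lim_coef (x ^+ p * iota u) k = x * iota (lim_coef u k).
    pose v : ext pp (limP pp B) := [ffun k => x * iota (lim_coef u k)].
    have -> : x ^+ p * iota u = rfrob v.
      rewrite -{1}(lim_coefE u) rmorph_sum mulr_sumr; apply: eq_bigr => l _.
      by rewrite !ffunE rmorphM rmorphXn exprMn mulrA /= lim_map_mon.
    by have /ffunP/(_ k) := lim_coefK v; rewrite !ffunE.
  have -> : lev 0 u = \sum_k lev 0 (lim_coef u k) ^+ p * mon A (expo_val k).
    rewrite -{1}(lim_coefE u) lev_rfrob; apply: eq_bigr => k _.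
    by rewrite ffunE.
  rewrite pure_sum; apply: eq_bigr => k _.
  by rewrite coefE rmorphM /= -gE mulrC pureZ.
have phi_sum (J' : finType) (F : J' -> D) : phi (\sum_j F j) = \sum_j phi (F j).
  exact: (big_morph phi phiD phi0).
have phiJ x : q x = 0 -> phi x = 0.
  move=> /kerq[r [w [u [w0 ->]]]]; rewrite mxE phi_sum big1 // => j _.
  rewrite mxE -(lim_coefE (u j 0)) mulr_sumr phi_sum big1 // => k _.
  rewrite ffunE -(lim_map_mon pp f) mulrCA -rmorphM phiE rmorphM /= w0 mul0r.
  exact: pure0.
have /choice[s sE] := surjq.
have phi_eq x y : q x = q y -> phi x = phi y.
  move=> /eqP; rewrite -subr_eq0 -rmorphB => /eqP/phiJ xy.
  by rewrite -[x](subrK y) phiD xy add0r.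
exists (fun t => phi (s t)) => [z|t]; last first.
  rewrite /phi rmorph_sum -[RHS]sE -[in RHS](lim_coefE (s t)) rmorph_sum.
  apply: eq_bigr => k _ /=; rewrite rel_Frobenius_pure ffunE rmorphM rmorphXn.
  by congr (_ * _); rewrite [LHS](gE (mon (limP pp A) _)) /= lim_map_mon.
elim/tensor_ind: z => [|x y IHx IHy|t a].
- by rewrite raddf0 (phi_eq _ 0) ?phi0 // sE rmorph0.
- rewrite -[in RHS]IHx -[in RHS]IHy -phiD; apply: phi_eq.
  by rewrite [RHS]rmorphD !sE; apply: (raddfD (rel_Frobenius (f := g) (chA := chA))). 
- have [u <-] := lev0_surj surjA a; rewrite -(sE t).
  rewrite [LHS](phi_eq _ (s t ^+ p * iota u)); first exact: phiE.
  rewrite sE -/(alg_pure _ _ _ _) rel_Frobenius_pure rmorphM rmorphXn gE.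
  by rewrite !sE.
Qed.

End Factorization.

Lemma pring_factorization (p : nat) (pp : prime p) (I : finType) (A B : pring p I)
    (f : phom A B) (chA : is_Fp_algebra p A) :
    surjective (rfrob (B := A) : ext pp A -> A) ->
    surjective (rfrob (B := B) : ext pp B -> B) ->
  exists (T : comPzRingType) (g : {rmorphism A -> T}) (h : {rmorphism T -> B}),
    [/\ forall a, h (g a) = f a, surjective h,
        bijective (rel_Frobenius (f := g) (chA := chA)),
        noetherian A -> forall r (l : 'rV[A]_r), syz_generated g l &
        noetherian B -> noetherian T].
Proof.
move=> surjA surjB.
have [T [q [surjq kerq]]] := quotient_ring_exists (kernel_ext_ideal pp f).
have ker0 x : q x = 0 -> lev 0 x = 0.
  move=> /kerq[r [w [u [w0 ->]]]]; rewrite mxE rmorph_sum big1 // => j _.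
  by rewrite mxE rmorphM [X in X * _]lev0_limM w0 rmorph0 mul0r.
have [h hE] := rmorphism_factor (f := lim_base pp B) surjq ker0.
have [|g gE] := rmorphism_factor (q := lim_base pp A)
    (f := q \o limM pp f : {rmorphism _ -> _}) (lev0_surj surjA).
  move=> x x0 /=; apply/kerq; exists 1%N, x%:M, 1%:M; split=> [j|].
    by rewrite ord1 mxE eqxx mulr1n.
  by rewrite mulmx1 !mxE eqxx mulr1n.
exists T, g, h; split.
- move=> a; have [x <-] := lev0_surj surjA a.
  by rewrite [g _](gE x) /= hE.
- by move=> b; have [x <-] := lev0_surj surjB b; exists (q x); apply: hE.
- exact: (quotient_relatively_perfect surjA surjq kerq gE).
- by move=> noethA r l; apply: (quotient_flat surjA surjq kerq gE).
- by move=> noethB; apply: noetherian_surj surjq _; apply: lim_noetherian.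
Qed.

(** * Flatness and tensor products *)

Section FlatTensor.
Variables (A T : comPzRingType) (g : {rmorphism A -> T}).
Hypothesis flat : forall r (l : 'rV[A]_r), syz_generated g l.
Local Notation "M ^g" := (map_mx g M) (at level 2, format "M ^g").

Definition lincomb r (y : 'cV[T]_r) (b : 'rV[A]_r) : restr g := (b^g *m y) 0 0.

Lemma lincomb_mulmx r q (y : 'cV[T]_r) (y' : 'cV_q) (E : 'M[A]_(r, q)) b :
  y = E^g *m y' -> lincomb y b = lincomb y' (b *m E).
Proof. by move=> ->; rewrite /lincomb map_mxM mulmxA. Qed.

Section Refine.
Variable Z : lmodType A.

Definition spread r (y : 'cV[T]_r) (s' : seq ('rV[A]_r * Z)) : seq (restr g * Z) :=
  [seq (lincomb y x.1, x.2) | x <- s'].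

Definition coefs r (s' : seq ('rV[A]_r * Z)) (j : 'I_r) : Z :=
  \sum_(x <- s') x.1 0 j *: x.2.

Definition push r q (E : 'M[A]_(r, q)) (s' : seq ('rV[A]_r * Z)) :=
  [seq (x.1 *m E, x.2) | x <- s'].

Lemma spread_push r q (y : 'cV[T]_r) (y' : 'cV_q) (E : 'M[A]_(r, q)) s' :
  y = E^g *m y' -> spread y' (push E s') = spread y s'.
Proof.
move=> yE; rewrite /spread /push -map_comp; apply: eq_map => x /=.
by rewrite (lincomb_mulmx _ yE).
Qed.

Lemma coefs_push r q (E : 'M[A]_(r, q)) s' k :
  coefs (push E s') k = \sum_j E j k *: coefs s' j.
Proof.
rewrite /coefs big_map.
under [RHS]eq_bigr => j _ do rewrite scaler_sumr.
rewrite exchange_big; apply: eq_bigr => x _ /=.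
by rewrite mxE scaler_suml; apply: eq_bigr => j _; rewrite scalerA mulrC.
Qed.

Lemma col_mx_lshift r q (y : 'cV[T]_r) (y' : 'cV_q) :
  y = (row_mx 1%:M 0)^g *m col_mx y y'.
Proof. by rewrite map_row_mx map_mx1 raddf0 mul_row_col mul1mx mul0mx addr0. Qed.
Lemma col_mx_rshift r q (y : 'cV[T]_r) (y' : 'cV_q) :
  y' = (row_mx 0 1%:M)^g *m col_mx y y'.
Proof. by rewrite map_row_mx map_mx1 raddf0 mul_row_col mul1mx mul0mx add0r. Qed.

Lemma spread_exists (s : seq (restr g * Z)) : exists r (y : 'cV[T]_r) s', s = spread y s'.
Proof.
elim: s => [|[t z] s [r [y [s' ->]]]]; first by exists 0%N, 0, [::].
exists (1 + r)%N, (col_mx (t : T)%:M y), ((row_mx 1%:M 0, z) :: push (row_mx 0 1%:M) s').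
rewrite /= -/(spread _ _) (spread_push _ (col_mx_rshift _ _)).
rewrite /lincomb -col_mx_lshift mxE eqxx mulr1n.
by [].
Qed.

(* Two formal sums become equal after writing the elements of T occurring in
   them as combinations of common elements y_j of T, and collecting over y_j. *)
Definition coequal (s t : seq (restr g * Z)) : Prop := exists r (y : 'cV[T]_r) s' t',
  [/\ s = spread y s', t = spread y t' & forall j, coefs s' j = coefs t' j].

(** Flatness enters here, for the transitivity of [coequal]: equality of two entries is a relation
    on the [y_j], and refining the [y_j] makes it hold already between the coefficients in [A]. One
    entry is treated at a time. *)
Lemma spread_common r1 r2 (y1 : 'cV[T]_r1) (y2 : 'cV[T]_r2) t1 t2 :
  spread y1 t1 = spread y2 t2 ->
  exists q (E1 : 'M[A]_(r1, q)) (E2 : 'M[A]_(r2, q)) (y : 'cV[T]_q),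
    [/\ y1 = E1^g *m y, y2 = E2^g *m y & push E1 t1 = push E2 t2].
Proof.
elim: t1 t2 => [|[b1 z1] t1 IHt] [|[b2 z2] t2] //.
  move=> _; exists (r1 + r2)%N, (row_mx 1%:M 0), (row_mx 0 1%:M), (col_mx y1 y2).
  by split=> //; [apply: col_mx_lshift|apply: col_mx_rshift].
case=> b12 <- /IHt[q [E1 [E2 [y [y1E y2E tE]]]]].
have [|q' [E [y' [yE bE]]]] := @flat _ (b1 *m E1 - b2 *m E2) y.
  rewrite map_mxB mulmxBl; apply/eqP; rewrite subr_eq0; apply/eqP/matrixP=> i j.
  rewrite !ord1 -[LHS]/(lincomb y (b1 *m E1)) -[RHS]/(lincomb y (b2 *m E2)).
  by rewrite -(lincomb_mulmx _ y1E) -(lincomb_mulmx _ y2E).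
have E12 : b1 *m (E1 *m E) = b2 *m (E2 *m E).
  by apply/eqP; rewrite !mulmxA -subr_eq0 -mulmxBl bE.
exists q', (E1 *m E), (E2 *m E), y'; split.
- by rewrite map_mxM -mulmxA -yE.
- by rewrite map_mxM -mulmxA -yE.
rewrite /= E12; congr (_ :: _).
have pushM r (F : 'M[A]_(r, q)) s' : push (F *m E) s' = push E (push F s').
  by rewrite /push -map_comp; apply: eq_map => x /=; rewrite mulmxA.
by rewrite -!/(push _ _) !pushM tE.
Qed.

Lemma coequal_sym s t : coequal s t -> coequal t s.
Proof. by case=> r [y [s' [t' [sE tE st]]]]; exists r, y, t', s'; split. Qed.

Lemma coequal_trans s t u : coequal s t -> coequal t u -> coequal s u.
Proof.
move=> [r1 [y1 [s1 [t1 [-> -> st]]]]] [r2 [y2 [t2 [u2 [tE -> tu]]]]].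
have [q [E1 [E2 [y [y1E y2E t12]]]]] := spread_common tE.
exists q, y, (push E1 s1), (push E2 u2).
split=> [||j]; rewrite ?(spread_push _ y1E) ?(spread_push _ y2E) //.
transitivity (coefs (push E1 t1) j).
  by rewrite !coefs_push; apply: eq_bigr => k _; rewrite st.
by rewrite t12 !coefs_push; apply: eq_bigr => k _; rewrite tu.
Qed.

Lemma coefs_cat r (s' t' : seq ('rV[A]_r * Z)) j :
  coefs (s' ++ t') j = coefs s' j + coefs t' j.
Proof. exact: big_cat. Qed.

Lemma coequal_cat s s1 t t1 : coequal s s1 -> coequal t t1 -> coequal (s ++ t) (s1 ++ t1).
Proof.
move=> [r1 [y1 [s' [s1' [-> -> ss1]]]]] [r2 [y2 [t' [t1' [-> -> tt1]]]]].
have y1E := col_mx_lshift y1 y2; have y2E := col_mx_rshift y1 y2.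
exists (r1 + r2)%N, (col_mx y1 y2),
  (push (row_mx 1%:M 0) s' ++ push (row_mx 0 1%:M) t'),
  (push (row_mx 1%:M 0) s1' ++ push (row_mx 0 1%:M) t1').
split=> [||j].
- by rewrite [RHS]map_cat -!/(spread _ _) (spread_push _ y1E) (spread_push _ y2E).
- by rewrite [RHS]map_cat -!/(spread _ _) (spread_push _ y1E) (spread_push _ y2E).
rewrite !coefs_cat !coefs_push.
by congr (_ + _); apply: eq_bigr => k _; rewrite ?ss1 ?tt1.
Qed.

Lemma tens_eqv_coequal s t : tens_eqv s t -> coequal s t.
Proof.
have refl s1 : coequal s1 s1.
  by have [r [y [s' ->]]] := spread_exists s1; exists r, y, s', s'.
have lin1 (m : T) (b : A) : lincomb m%:M b%:M = g b * m.
  by rewrite /lincomb map_scalar_mx -scalar_mxM mxE eqxx mulr1n.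
elim=> {s t} [s|s t _|s t u _ + _|s s' t t' _ + _|s t|n|m m' n|m n n'|a m n].
- exact: refl.
- exact: coequal_sym.
- exact: coequal_trans.
- exact: coequal_cat.
- have [r1 [y1 [s' ->]]] := spread_exists s; have [r2 [y2 [t' ->]]] := spread_exists t.
  have y1E := col_mx_lshift y1 y2; have y2E := col_mx_rshift y1 y2.
  exists (r1 + r2)%N, (col_mx y1 y2),
    (push (row_mx 1%:M 0) s' ++ push (row_mx 0 1%:M) t'),
    (push (row_mx 0 1%:M) t' ++ push (row_mx 1%:M 0) s').
  split=> [||j]; last by rewrite !coefs_cat addrC.
    by rewrite [RHS]map_cat -!/(spread _ _) (spread_push _ y1E) (spread_push _ y2E).
  by rewrite [RHS]map_cat -!/(spread _ _) (spread_push _ y1E) (spread_push _ y2E).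
- exists 0%N, 0, [:: (0, n)], [::]; split=> [||[]] //.
  by rewrite /= /lincomb mulmx0 mxE.
- exists (1 + 1)%N, (col_mx (m : T)%:M (m' : T)%:M), [:: (row_mx 1%:M 1%:M, n)],
    [:: (row_mx 1%:M 0, n); (row_mx 0 1%:M, n)].
  have cE (b b' : A) : lincomb (col_mx (m : T)%:M (m' : T)%:M) (row_mx b%:M b'%:M) = g b * m + g b' * m'.
    by rewrite /lincomb map_row_mx mul_row_col mxE -![(_ *m _) _ _]/(lincomb _ _) !lin1.
  split=> [||j].
  + by rewrite /= cE rmorph1 !mul1r.
  + by rewrite -(raddf0 (@scalar_mx A 1)) /= !cE rmorph1 rmorph0 !mul1r !mul0r addr0 add0r.
  + rewrite /coefs big_cons !big_nil big_cons big_seq1 /= addr0 -scalerDl.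
    congr (_ *: _); rewrite ![row_mx _ _ _ _]mxE.
    by case: (split j) => k; rewrite [(0 : 'M_1) _ _]mxE ?addr0 ?add0r.
- exists 1%N, (m : T)%:M, [:: (1%:M, n + n')], [:: (1%:M, n); (1%:M, n')].
  split=> [||j]; rewrite /= ?lin1 ?rmorph1 ?mul1r //.
  by rewrite /coefs big_cons !big_nil big_cons big_seq1 /= addr0 -scalerDr.
- exists 1%N, (m : T)%:M, [:: (a%:M, n)], [:: (1%:M, a *: n)].
  split=> [||j]; rewrite /= ?lin1 ?rmorph1 ?mul1r //.
  by rewrite /coefs !big_seq1 /= ord1 !mxE eqxx !mulr1n scale1r.
Qed.

Lemma tens_of_eq0 (s : seq (restr g * Z)) : tens_of s = 0 ->
  exists r (y : 'cV[T]_r) s', s = spread y s' /\ forall j, coefs s' j = 0.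
Proof.
move=> /eqP/tens_ofP/tens_eqv_coequal[r [y [s' [t' [sE tE st]]]]].
exists r, y, s'; split=> // j; rewrite st.
by case: t' tE {st} => // _; rewrite /coefs big_nil.
Qed.

End Refine.

Lemma tensor_map_of (Y Z : lmodType A) (v : {linear Y -> Z}) (s : seq (restr g * Y)) :
  tensor_map v (tens_of s) = tens_of [seq (x.1, v x.2) | x <- s].
Proof. by rewrite !tens_of_sum big_map raddf_sum; apply: eq_bigr => x _; apply: tensor_map_pure. Qed.

Lemma tensor_map_surj (Y Z : lmodType A) (v : {linear Y -> Z}) :
  surjective v -> surjective (@tensor_map A (restr g) Y Z v).
Proof.
move=> surjv; elim/tensor_ind=> [|x y [x' <-] [y' <-]|t z].
- by exists 0; rewrite raddf0.
- by exists (x' + y'); rewrite raddfD.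
- by have [y <-] := surjv z; exists (pure_tensor t y); apply: tensor_map_pure.
Qed.

(** After refinement an element of the kernel is [sum y_j (x) c_j] with every [v c_j = 0], so each
    [c_j] lifts through [u]. *)
Lemma tensor_map_exact (X Y Z : lmodType A) (u : {linear X -> Y}) (v : {linear Y -> Z}) :
    (forall y, v y = 0 <-> exists x, u x = y) ->
  forall w : tensor (restr g) Y,
    tensor_map v w = 0 <-> exists w' : tensor (restr g) X, tensor_map u w' = w.
Proof.
move=> uv w; split=> [|[w' <-]]; last first.
  elim/tensor_ind: w' => [|x y IHx IHy|t x]; first by rewrite !raddf0.
    by rewrite !raddfD /= IHx IHy addr0.
  rewrite !tensor_map_pure (uv (u x)).2; last by exists x.
  by apply: (addrI (pure_tensor t 0)); rewrite -pure_tensorDr !addr0.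
have [s ->] := tens_elimP w; rewrite tensor_map_of => /tens_of_eq0[r [y [s' [sE s'0]]]].
have [s2 [s2E s2E']] : exists s2 : seq ('rV[A]_r * Y),
    s = spread y s2 /\ s' = [seq (x.1, v x.2) | x <- s2].
  elim: s s' sE {s'0} => [|[t z] s IHs] [|[b z'] s'] //=; first by exists [::].
  case=> -> <- /IHs[s2 [-> ->]]; by exists ((b, z) :: s2).
have /choice[x xE] : forall j, exists x, u x = coefs s2 j.
  move=> j; apply/uv; rewrite raddf_sum -[RHS](s'0 j) s2E' /coefs big_map.
  by apply: eq_bigr => b _; rewrite /= linearZ.
exists (\sum_j pure_tensor (y j 0 : restr g) (x j)); rewrite raddf_sum s2E tens_of_sum big_map.
transitivity (\sum_(b <- s2) \sum_j pure_tensor (y j 0 : restr g) (b.1 0 j *: b.2)).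
  rewrite exchange_big; apply: eq_bigr => j _; rewrite /= tensor_map_pure xE.
  have pure0 : pure_tensor (y j 0 : restr g) (0 : Y) = 0.
    by apply: (addrI (pure_tensor (y j 0 : restr g) (0 : Y))); rewrite -pure_tensorDr !addr0.
  exact: (big_morph (pure_tensor (y j 0 : restr g)) (pure_tensorDr _) pure0).
apply: eq_bigr => b _; rewrite /lincomb mxE.
have pure0 : pure_tensor (0 : restr g) b.2 = 0.
  by apply: (addrI (pure_tensor (0 : restr g) b.2)); rewrite -pure_tensorDl !addr0.
rewrite (big_morph (fun t : restr g => pure_tensor t b.2) (fun t t' => pure_tensorDl t t' _) pure0).
apply: eq_bigr => j _; rewrite mxE pure_tensorZr -pure_tensorZl.
by [].
Qed.

(** By flatness, [T (x)_A Q] is a resolution of [T (x)_A F_*A], so the derived relative Frobenius is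
    the discrete one. *)
Lemma flat_relatively_perfect (p : nat) (chA : is_Fp_algebra p A) :
  bijective (rel_Frobenius (f := g) (chA := chA)) -> relatively_perfect g chA.
Proof.
move=> bijF Q d e [_ [surje ker_e ker_d]].
have F0 x : rel_Frobenius (f := g) (chA := chA) x = 0 <-> x = 0.
  by split=> [x0|->]; [apply: (bij_inj bijF); rewrite raddf0|rewrite raddf0].
split=> [z|x|n x].
- case: bijF => F' _ F'K; have [x xE] := tensor_map_surj surje (F' z).
  by exists x; rewrite xE F'K.
- by rewrite F0; apply: tensor_map_exact.
- by apply: tensor_map_exact; apply: ker_d.
Qed.

End FlatTensor.

(** * Polynomial rings *)

(** With an equality rather than an isomorphism, case analysis replaces [P] by a nonzero ring
    everywhere. *)
Lemma comNzRing_of (P : comPzRingType) : 1 != 0 :> P ->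
  exists P0 : comNzRingType, (P0 : comPzRingType) = P.
Proof.
case: P => P c /= nz.
pose h := GRing.PzSemiRing_isNonZero.Build (GRing.ComPzRing.Pack c) nz.
pose P0 : comNzRingType := HB.pack (GRing.ComPzRing.sort (GRing.ComPzRing.Pack c)) h.
by exists P0; move: nz @h @P0; case: c.
Qed.

Lemma zero_ring (P : comPzRingType) : 1 = 0 :> P -> forall x y : P, x = y.
Proof. by move=> P0 x y; rewrite -[x]mul1r -[y]mul1r P0 !mul0r. Qed.

Lemma Hilbert_basis (A : comNzRingType) : noetherian A -> noetherian {poly A}.
Proof.
move=> noethA; apply/noetherianP => J idJ; case: (idJ) => J0 JD JM.
(* [d] only bounds the degree, so that 0 qualifies and sums whose leading terms cancel are no
   exception. *)
pose lc a := exists x d, [/\ J x, (size x <= d.+1)%N & x`_d = a].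
have [|r [l lP]] := (noetherianP A).1 noethA lc.
  split=> [|_ _ [x [d [Jx sx <-]]] [y [e [Jy sy <-]]]|a _ [x [d [Jx sx <-]]]].
  - by exists 0, 0%N; rewrite size_poly0 coef0.
  - exists ('X^e * x + 'X^d * y), (d + e)%N; split; first by apply: JD; apply: JM.
      rewrite (leq_trans (size_polyD _ _)) // geq_max !(leq_trans (size_polyMleq _ _)) //.
        by rewrite size_polyXn addSn /= -addnS leq_add2l.
      by rewrite size_polyXn addSn /= (addnC e) -addSn leq_add2r.
    by rewrite coefD !coefXnM !ltnNge leq_addl leq_addr /= addnK addKn.
  - exists (a%:P * x), d; split; first exact: JM.
      by rewrite mul_polyC (leq_trans (size_scale_leq _ _)).
    by rewrite coefCM.
have /choice[g gP] : forall t, exists xd : {poly A} * nat,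
    [/\ J xd.1, (size xd.1 <= xd.2.+1)%N & xd.1`_xd.2 = l 0 t].
  by move=> t; have [x [d xP]] := fg_ideal_gen t lP; exists (x, d).
(* From degree [d0] on, shifted generators cancel leading terms; the polynomials of [J] of degree
   below [d0] form a submodule of [A^d0]. *)
pose d0 := \max_t (g t).2.
have led0 t : ((g t).2 <= d0)%N by apply: (leq_bigmax t).
pose z t := 'X^(d0 - (g t).2) * (g t).1.
have Jz t : J (z t) by apply: JM; case: (gP t).
have [|q [m mP]] := @noetherian_submodule A d0 (fun v => J (rVpoly v^T)) noethA.
  split=> [|v w Jv Jw|a v Jv]; first by rewrite trmx0 raddf0.
    by rewrite linearD raddfD /=; apply: JD.
  by rewrite linearZ linearZ /= -mul_polyC; apply: JM.
pose y (j : 'I_q) := rVpoly (col j m)^T.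
have Jy j : J (y j) by apply: (generates_col j mP).
apply: (fg_ideal_row (l1 := \row_t z t) (l2 := \row_j y j) idJ).
- by move=> t; rewrite mxE.
- by move=> j; rewrite mxE.
move=> x; have [n] := ubnP (size x); elim: n x => // n IHn x; rewrite ltnS => sx Jx.
have [small|big] := leqP (size x) d0.
  have [|u uE] := (mP (poly_rV x)^T).1; first by rewrite trmxK poly_rV_K.
  exists 0, (map_mx polyC u); rewrite mulmx0 mxE add0r.
  rewrite -(poly_rV_K small) -[poly_rV x]trmxK uE.
  have -> : m *m u = \sum_j u j 0 *: col j m.
    apply/matrixP=> i k; rewrite ord1 !mxE summxE; apply: eq_bigr => j _.
    by rewrite !mxE mulrC.
  rewrite raddf_sum raddf_sum mxE; apply: eq_bigr => j _ /=.
  by rewrite linearZ linearZ /= !mxE mulrC mul_polyC.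
pose d := (size x).-1.
have sxd : size x = d.+1 by rewrite prednK // (leq_ltn_trans _ big).
have [|u uE] := (lP x`_d).1; first by exists x, d; rewrite sxd.
have d0d : (d0 <= d)%N by rewrite -ltnS -sxd.
pose x' := x - (\row_t z t *m \col_t (u t 0 *: 'X^(d - d0))) 0 0.
have Jx' : J x'.
  apply: JD => //; rewrite -mulN1r; apply: JM; apply: ideal_mulmx => // t.
  by rewrite mxE.
have x'E : x' = x - \sum_t u t 0 *: ('X^(d - d0) * z t).
  by rewrite /x' mxE; congr (_ - _); apply: eq_bigr => t _; rewrite !mxE -scalerAr mulrC.
have zd t i : (d0 < i)%N -> (z t)`_i = 0.
  move=> d0i; rewrite coefXnM; case: ltnP => // _.
  case: (gP t) => _ st _; rewrite nth_default // (leq_trans st) //.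
  by rewrite ltn_subRL subnK.
have zd0 t : (z t)`_d0 = l 0 t.
  rewrite coefXnM ltnNge leq_subr /= subKn //.
  by case: (gP t).
have sx' : (size x' <= d)%N.
  apply/leq_sizeP => i di; rewrite x'E coefB coef_sum.
  under eq_bigr => t _ do rewrite coefZ coefXnM ltnNge (leq_trans (leq_subr _ _) di) /=.
  move: di; rewrite leq_eqVlt => /predU1P[<-|di]; last first.
    rewrite nth_default ?sxd // big1 ?subrr // => t _; rewrite zd ?mulr0 //.
    by rewrite ltn_subRL subnK.
  rewrite uE mxE -sumrB big1 // => t _.
  by rewrite subKn // zd0 mulrC subrr.
have [|v1 [v2 vE]] := IHn x' _ Jx'; first by rewrite (leq_trans _ sx) // sxd ltnS.
exists (v1 + \col_t (u t 0 *: 'X^(d - d0))), v2.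
by rewrite mulmxDr [X in X + _]mxE addrAC -vE subrK.
Qed.

(** One sequence [a] serves for all large [N], so that finitely many coefficients can share a degree
    bound when variables are added one by one. *)
Definition polynomial_extension (P P' : comPzRingType) (j : {rmorphism P -> P'}) (X : P') : Prop :=
  [/\ forall q, exists N0 (a : nat -> P), forall N, (N0 <= N)%N ->
        q = \sum_(t < N) j (a t) * X ^+ t,
      forall N (a : 'I_N -> P), \sum_t j (a t) * X ^+ t = 0 -> forall t, a t = 0,
      noetherian P -> noetherian P' &
      forall (S : comPzRingType) (f : {rmorphism P -> S}) s,
        exists f' : {rmorphism P' -> S}, (forall a, f' (j a) = f a) /\ f' X = s].

Lemma poly_extension (P : comNzRingType) :
  polynomial_extension (polyC : {rmorphism P -> {poly P}}) 'X.
Proof.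
split=> [q|N a a0 t||S f s].
- exists (size q), (nth 0 q) => N sq; apply/polyP => i.
  rewrite coef_sum; under eq_bigr => t _ do rewrite coefCM coefXn.
  have [iN|Ni] := ltnP i N; last first.
    rewrite nth_default ?(leq_trans sq) // big1 // => t _.
    by rewrite gtn_eqF ?mulr0 // (leq_trans _ Ni).
  rewrite (bigD1 (Ordinal iN)) //= eqxx mulr1 big1 ?addr0 // => t ti.
  by rewrite eq_sym -[_ == i]/(t == Ordinal iN) (negPf ti) mulr0.
- have := congr1 (fun q : {poly P} => q`_t) a0; rewrite coef0 coef_sum.
  under eq_bigr => k _ do rewrite coefCM coefXn.
  rewrite (bigD1 t) //= eqxx mulr1 big1 ?addr0 // => k kt.
  by rewrite eq_sym -[_ == _ :> nat]/(k == t) (negPf kt) mulr0.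
- exact: Hilbert_basis.
have [S0|S0] := eqVneq (1 : S) 0.
  exists (f \o horner_eval 0 : {rmorphism _ -> _}); split=> [a|]; exact: zero_ring.
have [S1 S1E] := comNzRing_of S0; case: S / S1E f s {S0} => f s.
have cfs : commr_rmorph f s by move=> x; apply: mulrC.
exists (horner_morph cfs : {rmorphism _ -> _}); split=> [a|].
  exact: horner_morphC.
exact: horner_morphX.
Qed.

Lemma polynomial_extension_exists (P : comPzRingType) :
  exists (P' : comPzRingType) (j : {rmorphism P -> P'}) (X : P'), polynomial_extension j X.
Proof.
have [P0|/comNzRing_of[P1 <-]] := eqVneq (1 : P) 0; last first.
  by exists {poly P1}, (polyC : {rmorphism P1 -> {poly P1}}), 'X; apply: poly_extension.
(* Polynomials over the zero ring form the zero ring, so [P] itself serves. *)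
exists P, (idfun : {rmorphism P -> P}), 0; split=> [q|N a _ t|//|S f s].
- by exists 0%N, (fun=> 0) => N _; apply: zero_ring.
- exact: zero_ring.
- exists f; split=> //; apply: zero_ring.
  by rewrite -(rmorph1 f) P0 rmorph0.
Qed.

Lemma polynomial_ring_exists (R : comPzRingType) n :
  exists (R' : comPzRingType) (i : {rmorphism R -> R'}) (y : 'I_n -> R'),
    [/\ is_polynomial_ring_in i y, noetherian R -> noetherian R' &
        forall (S : comPzRingType) (f : {rmorphism R -> S}) (s : 'I_n -> S),
          exists f' : {rmorphism R' -> S}, (forall a, f' (i a) = f a) /\ forall j, f' (y j) = s j].
Proof.
suff [R' [i [y [genR' R'0 noethR' univR']]]] :
  exists (R' : comPzRingType) (i : {rmorphism R -> R'}) (y : 'I_n -> R'),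
    [/\ forall q : R', exists N0 (c : {ffun 'I_n -> nat} -> R), forall N, (N0 <= N)%N ->
          q = polynomial_eval i y (fun m : {ffun 'I_n -> 'I_N} => c [ffun j => m j : nat]),
        forall N (c : {ffun 'I_n -> 'I_N} -> R), polynomial_eval i y c = 0 -> forall m, c m = 0,
        noetherian R -> noetherian R' &
        forall (S : comPzRingType) (f : {rmorphism R -> S}) (s : 'I_n -> S),
          exists f' : {rmorphism R' -> S}, (forall a, f' (i a) = f a) /\ forall j, f' (y j) = s j].
  exists R', i, y; split=> //; split=> // q.
  have [N [c cE]] := genR' q; exists N; eexists; exact: cE.
elim: n => [|n [P [i [x [genP P0 noethP univP]]]]].
  exists R, (idfun : {rmorphism R -> R}), (fun=> 0).
  have eval0 N (c : {ffun 'I_0 -> 'I_N} -> R) (m : {ffun 'I_0 -> 'I_N}) :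
      polynomial_eval (idfun : {rmorphism R -> R}) (fun=> 0) c = c m.
    rewrite /polynomial_eval (bigD1 m) //= big_ord0 mulr1 big1 ?addr0 // => m' /eqP[].
    by apply/ffunP=> -[].
  split=> [q|N c c0 m|//|S f s].
  - exists 0%N, (fun=> q) => N _; rewrite eval0 //.
    by apply: finfun => -[].
  - by rewrite -c0; apply/esym/eval0.
  - by exists f; split=> // -[].
have [P' [j [X [genP' P'0 noethP' univP']]]] := polynomial_extension_exists P.
pose y (k : 'I_n.+1) := if unlift ord0 k is Some k' then j (x k') else X.
pose cons (T : Type) (t : T) (m : {ffun 'I_n -> T}) : {ffun 'I_n.+1 -> T} :=
  [ffun k => if unlift ord0 k is Some k' then m k' else t].
pose tail (T : Type) (m : {ffun 'I_n.+1 -> T}) : {ffun 'I_n -> T} := [ffun k => m (lift ord0 k)].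
have cons0 T (t : T) m : cons T t m ord0 = t by rewrite ffunE unlift_none.
have consS T (t : T) m k : cons T t m (lift ord0 k) = m k by rewrite ffunE liftK.
have consK T (m : {ffun 'I_n.+1 -> T}) : cons T (m ord0) (tail T m) = m.
  by apply/ffunP=> k; rewrite !ffunE; case: unliftP => [k' ->|->]; rewrite ?ffunE.
have tailK T (t : T) m : tail T (cons T t m) = m.
  by apply/ffunP=> k; rewrite ffunE consS.
have evalE N (c : {ffun 'I_n.+1 -> 'I_N} -> R) :
    polynomial_eval (j \o i : {rmorphism R -> P'}) y c =
    \sum_(t < N) j (polynomial_eval i x (fun m => c (cons _ t m))) * X ^+ t.
  rewrite /polynomial_eval.
  rewrite (reindex (fun tm : 'I_N * {ffun 'I_n -> 'I_N} => cons _ tm.1 tm.2)) /=; last first.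
    apply: onW_bij; exists (fun m : {ffun 'I_n.+1 -> 'I_N} => (m ord0, tail _ m)) => [[t m]|m] /=.
      by rewrite cons0 tailK.
    exact: consK.
  rewrite -(pair_bigA _ (fun t m => j (i (c (cons _ t m))) *
    \prod_(k < n.+1) y k ^+ cons _ t m k)) /=.
  apply: eq_bigr => t _; rewrite rmorph_sum mulr_suml; apply: eq_bigr => m _ /=.
  rewrite big_ord_recl /y unlift_none cons0 rmorphM rmorph_prod -mulrA mulrCA.
  rewrite [RHS]mulrA [RHS]mulrC; congr (_ * (_ * _)); apply: eq_bigr => k _.
  by rewrite liftK consS rmorphXn.
exists P', (j \o i : {rmorphism R -> P'}), y; split=> [q|N c|/noethP/noethP'//|S f s].
- have [N0 [a aE]] := genP' q; have /choice[Nc NcP] : forall t, exists Nc : nat * ({ffun 'I_n -> nat} -> R),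
      forall N, (Nc.1 <= N)%N ->
        a t = polynomial_eval i x (fun m : {ffun 'I_n -> 'I_N} => Nc.2 [ffun j => m j : nat]).
    by move=> t; have [N [c cE]] := genP (a t); exists (N, c).
  exists (maxn N0 (\max_(t < N0) (Nc t).1)),
    (fun m : {ffun 'I_n.+1 -> nat} => if (m ord0 < N0)%N then (Nc (m ord0)).2 (tail _ m) else 0) => N.
  rewrite geq_max => /andP[N0N maxN]; rewrite evalE [LHS](aE N0 (leqnn _)).
  rewrite (big_ord_widen _ (fun t => j (a t) * X ^+ t) N0N) big_mkcond.
  apply: eq_bigr => t _; case: ifP => tN0; last first.
    rewrite /polynomial_eval big1 ?rmorph0 ?mul0r // => m _.
    by rewrite ffunE cons0 tN0 rmorph0 mul0r.
  congr (j _ * _); rewrite (NcP t N); last first.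
    by apply: leq_trans maxN; apply: (leq_bigmax (Ordinal tN0)).
  apply: eq_bigr => m _; congr (i _ * _); rewrite ffunE cons0 tN0; congr ((Nc _).2 _).
  by apply/ffunP=> k; rewrite !ffunE liftK.
- rewrite evalE => /P'0 c0 m; rewrite -[m]consK.
  exact: (P0 _ (fun m' => c (cons _ (m ord0) m')) (c0 (m ord0)) (tail _ m)).
- have [f1 [f1E f1x]] := univP S f (fun k => s (lift ord0 k)).
  have [f2 [f2E f2X]] := univP' S f1 (s ord0).
  exists f2; split=> [a|k]; first by rewrite /= f2E f1E.
  by rewrite /y; case: unliftP => [k' ->|->]; rewrite ?f2E ?f1x.
Qed.

(** * Choice of the p-generators and conclusion *)

Section Monomials.
Variables (p : nat) (I : finType) (A : comPzRingType) (chA : is_Fp_algebra p A) (z : I -> A).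

Definition monomial (a : {ffun I -> nat}) : A := \prod_k z k ^+ a k.

Fact monomial0 : monomial (expo0 I) = 1.
Proof. by apply: big1 => k _; rewrite ffunE expr0. Qed.
Fact monomialD a b : monomial (expo_add a b) = monomial a * monomial b.
Proof. by rewrite -big_split; apply: eq_bigr => k _; rewrite ffunE exprD. Qed.

Definition pring_of : pring p I := PRing chA monomial0 monomialD.

Lemma rfrob_pring_of (pp : prime p) (x : A) (k : I) :
  exists u : ext pp pring_of, rfrob u = x ^+ p * z k.
Proof.
exists (sgl pp (x : pring_of) [ffun l => (l == k) : nat]).
rewrite rfrob_sgl; congr (_ * _); rewrite [LHS](bigD1 k) //= ffunE eqxx expr1.
by rewrite big1 ?mulr1 // => l lk; rewrite ffunE (negPf lk) expr0.
Qed.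

End Monomials.

Theorem corollaryD (p : nat) (p_prime : prime p) (R S : comPzRingType)
    (chR : is_Fp_algebra p R) (chS : is_Fp_algebra p S)
    (f : {rmorphism R -> S}) (finR : F_finite chR) (finS : F_finite chS) :
  exists (R' T : comPzRingType) (i : {rmorphism R -> R'})
      (g : {rmorphism R' -> T}) (h : {rmorphism T -> S}),
    let chR' : is_Fp_algebra p R' := Fp_algebra_rmorph i chR in
    [/\ forall r, h (g (i r)) = f r,
        is_polynomial_ring i,
        bijective (rel_Frobenius (f := g) (chA := chR')) &
        surjective h] /\
    (noetherian R -> relatively_perfect g chR') /\
    (noetherian R -> noetherian S -> noetherian T).
Proof.
have [sR sRP] := finR; have [sS sSP] := finS.
have [R' [i [y [polyR' noethR' univR']]]] := polynomial_ring_exists R (size sS).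
have [f' [f'i f'y]] := univR' S f (fun j => sS`_j).
have chR' := Fp_algebra_rmorph i chR.
(* One family must serve both rings: the [y j] map to [p]-generators of [S], and the image of
   [rfrob] for [R'] is a subring containing [i] of [R] and the [y j], hence everything. *)
pose z (k : 'I_(size sR) + 'I_(size sS)) : R' :=
  match k with inl k => i sR`_k | inr j => y j end.
pose A := pring_of chR' z; pose B := pring_of chS (f' \o z).
have f'mon a : f' (mon A a) = mon B a.
  by rewrite rmorph_prod; apply: eq_bigr => k _; rewrite rmorphXn.
pose imA (x : R') := exists u : ext p_prime A, rfrob u = x.
have imAM x x' : imA x -> imA x' -> imA (x * x').
  by move=> [u <-] [u' <-]; exists (u * u'); rewrite rmorphM.
have imA1 : imA 1 by exists 1; rewrite rmorph1.
have imA_sum (J : finType) (F : J -> R') : (forall j, imA (F j)) -> imA (\sum_j F j).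
  move=> imF; apply: (big_ind imA) => [|x x' imx imx'|j _]; last exact: imF.
    by exists 0; rewrite raddf0.
  by case: imx imx' => u <- [u' <-]; exists (u + u'); rewrite raddfD.
have imA_i r : imA (i r).
  have [c ->] := sRP r; rewrite rmorph_sum; apply: imA_sum => k.
  rewrite rmorphM /Frobenius rmorphXn.
  exact: (rfrob_pring_of chR' z p_prime (i (c k)) (inl k)).
have imA_y j : imA (y j).
  have [u uE] := rfrob_pring_of chR' z p_prime 1 (inr j).
  by exists u; rewrite uE expr1n mul1r.
have surjA : surjective (rfrob (B := A) : ext p_prime A -> A).
  move=> x; have [N [c ->]] := polyR'.1 x; apply: imA_sum => m; apply: (imAM) => //.
  apply: (big_ind imA) => // j _.
  by elim: (nat_of_ord _) => [|e IHe]; rewrite ?expr0 // exprS; apply: imAM.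
have surjB : surjective (rfrob (B := B) : ext p_prime B -> B).
  move=> x; have [c ->] := sSP x.
  have /choice[u uE] : forall k, exists u : ext p_prime B, rfrob u = c k ^+ p * sS`_k.
    by move=> k; rewrite -f'y; apply: (rfrob_pring_of chS (f' \o z) p_prime (c k) (inr k)).
  by exists (\sum_k u k); rewrite raddf_sum; apply: eq_bigr => k _; apply: uE.
have [T [g [h [hg surjh bijF flatg noethT]]]] := pring_factorization
  (@PHom p _ A B f' f'mon) (Fp_algebra_rmorph i chR) surjA surjB.
exists R', T, i, g, h; split; first split=> //.
- by move=> r; rewrite hg /= f'i.
- by exists (size sS), y.
split=> [noethR|_ noethS]; last exact: noethT.
by apply: flat_relatively_perfect => //; apply: flatg; apply: noethR'.
Qed.
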